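(* Let $A$ be a non-selfinjective gendo-symmetric algebra and let $w$ denote the number of simple $A$-modules (up to isomorphism). Then for all integers $k \geq 1$, $$(o_k(A)+2-w)(k+2)-1 \;\geq\; \operatorname{domdim}(A).$$
   Context: All algebras are finite dimensional, connected and non-semisimple over a field $K$, and all modules are finite dimensional right modules. Dominant dimension: for a module $M$ with minimal injective resolution $0\to M\to I_0\to I_1\to\cdots$, $\operatorname{domdim}(M):=\sup\{n \mid I_i \text{ is projective for } i=0,1,\dots,n\}+1$ if $I_0$ is projective, and $\operatorname{domdim}(M):=0$ otherwise (the value $\infty$ is allowed). The dominant dimension of an algebra is that of its regular module. Gendo-symmetric: $A$ is gendo-symmetric if $A\cong \operatorname{End}_B(N)$ for a symmetric algebra $B$ and a generator $N$ of $\operatorname{mod}\text{-}B$ (in particular $\operatorname{domdim}(A)\geq 2$). Size: $\operatorname{size}(M)$ is the number of pairwise non-isomorphic indecomposable direct summands of $M$. $\operatorname{add}(M)$ is the full subcategory of direct summands of $M^n$, $n\geq 1$. For a subcategory $C$ of $\operatorname{mod}\text{-}A$ write $C\perp_r C$ if $\operatorname{Ext}^j_A(X,Y)=0$ for all $X,Y\in C$ and $j=1,\dots,r$. Define $$o_k(A):=\sup\{\operatorname{size}(M)\mid M\in \operatorname{mod}\text{-}A,\ \operatorname{add}(M)\perp_k \operatorname{add}(M)\}\in \mathbb{N}\cup\{\infty\};$$ if $o_k(A)=\infty$ the left-hand side of the inequality is read as $\infty$. *)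

(* Defs.v *)
From HB Require Import structures.
From mathcomp Require Import all_boot all_order all_algebra all_field.
From mathcomp Require Import boolp classical_sets constructive_ereal.

Set Implicit Arguments.
Unset Strict Implicit.
Unset Printing Implicit Defensive.

Import Order.TTheory GRing.Theory Num.Theory.
Local Open Scope classical_set_scope.
Local Open Scope ring_scope.

(* Finite-dimensional right modules over a finite-dimensional K-algebra A.
   [ract x a] is the product x a. *)
Record rmodule (K : fieldType) (A : falgType K) := RModule {
  rmod_sort :> vectType K;
  ract : rmod_sort -> A -> rmod_sort;
  ract_linearl : forall a, linear (ract^~ a);
  ract_linearr : forall x, linear (ract x);
  ract1 : forall x, ract x 1 = x;
  ractM : forall x a b, ract x (a * b) = ract (ract x a) b
}.

Section Constructions.
Variables (K : fieldType) (A : falgType K).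

Fact regular_linearl (a : A) : linear (fun x : A => x * a).
Proof. by move=> k x y; rewrite mulrDl scalerAl. Qed.

Fact regular_linearr (x : A) : linear (fun a : A => x * a).
Proof. by move=> k a b; rewrite mulrDr scalerAr. Qed.

Definition regular : rmodule A :=
  @RModule K A A (fun x a => x * a) regular_linearl regular_linearr
    (@mulr1 A) (@mulrA A).

Variables M N : rmodule A.

Definition rsum_act (x : (M * N)%type) (a : A) : (M * N)%type :=
  (ract x.1 a, ract x.2 a).

Fact rsum_linearl a : linear (rsum_act^~ a).
Proof. by move=> k x y; congr pair; apply: ract_linearl. Qed.

Fact rsum_linearr x : linear (rsum_act x).
Proof. by move=> k a b; congr pair; apply: ract_linearr. Qed.

Fact rsum_act1 x : rsum_act x 1 = x.
Proof. by case: x => x y; rewrite /rsum_act !ract1. Qed.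

Fact rsum_actM x a b : rsum_act x (a * b) = rsum_act (rsum_act x a) b.
Proof. by rewrite /rsum_act !ractM. Qed.

Definition rsum : rmodule A :=
  RModule rsum_linearl rsum_linearr rsum_act1 rsum_actM.

Variable n : nat.

Definition rpow_act (x : {ffun 'I_n -> M}) (a : A) : {ffun 'I_n -> M} :=
  [ffun i => ract (x i) a].

Fact rpow_linearl a : linear (rpow_act^~ a).
Proof. by move=> k x y; apply/ffunP => i; rewrite !ffunE ract_linearl. Qed.

Fact rpow_linearr x : linear (rpow_act x).
Proof. by move=> k a b; apply/ffunP => i; rewrite !ffunE ract_linearr. Qed.

Fact rpow_act1 x : rpow_act x 1 = x.
Proof. by apply/ffunP => i; rewrite !ffunE ract1. Qed.

Fact rpow_actM x a b : rpow_act x (a * b) = rpow_act (rpow_act x a) b.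
Proof. by apply/ffunP => i; rewrite !ffunE ractM. Qed.

Definition rpow : rmodule A :=
  RModule rpow_linearl rpow_linearr rpow_act1 rpow_actM.

End Constructions.

Arguments regular {K} A.

Section Modules.
Variables (K : fieldType) (A : falgType K).
Implicit Types M N P Q X Y : rmodule A.

Definition is_rhom M N (f : 'Hom(M, N)) :=
  forall x a, f (ract x a) = ract (f x) a.

Definition riso M N := exists2 f : 'Hom(M, N), is_rhom f & bijective f.

Definition is_submod M (U : {vspace M}) :=
  forall x a, x \in U -> ract x a \in U.

Definition rnonzero M := exists x : M, x != 0.

Definition is_simple M :=
  rnonzero M /\
  forall U : {vspace M}, is_submod U -> U = 0%VS \/ U = fullv.

Definition is_semisimple M :=
  forall U : {vspace M}, is_submod U -> exists W : {vspace M},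
    [/\ is_submod W, (U + W)%VS = fullv & (U :&: W)%VS = 0%VS].

Definition is_summand X M := exists Y, riso M (rsum X Y).

Definition is_indecomposable M :=
  rnonzero M /\
  forall X Y, riso M (rsum X Y) -> ~ rnonzero X \/ ~ rnonzero Y.

Definition in_add M X := exists2 n, (1 <= n)%N & is_summand X (rpow M n).

Definition is_projective P :=
  forall X Y (g : 'Hom(X, Y)) (f : 'Hom(P, Y)),
    is_rhom g -> is_rhom f -> limg g = fullv ->
    exists2 h : 'Hom(P, X), is_rhom h & f = (g \o h)%VF.

Definition is_injective Q :=
  forall X Y (g : 'Hom(X, Y)) (f : 'Hom(X, Q)),
    is_rhom g -> is_rhom f -> lker g = 0%VS ->
    exists2 h : 'Hom(Y, Q), is_rhom h & f = (h \o g)%VF.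

Definition is_essential M (U : {vspace M}) :=
  forall W : {vspace M}, is_submod W -> (U :&: W)%VS = 0%VS -> W = 0%VS.

(* The supremum, in N with +oo, of the number of members of a family of
   pairwise non-isomorphic modules satisfying C. *)
Definition iso_count (C : rmodule A -> Prop) : \bar int :=
  supremum 0%E [set c | exists n (X : 'I_n -> rmodule A),
    [/\ forall i, C (X i), forall i j, riso (X i) (X j) -> i = j
      & c = (n%:Z)%:E]].

Definition size_mod M : \bar int :=
  iso_count (fun X => is_indecomposable X /\ is_summand X M).

Definition num_simples : \bar int := iso_count is_simple.

(* ... -> pr_obj 1 -> pr_obj 0 -> X -> 0 *)
Record proj_resolution X := ProjResolution {
  pr_obj :> nat -> rmodule A;
  pr_diff : forall i, 'Hom(pr_obj i.+1, pr_obj i);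
  pr_aug : 'Hom(pr_obj 0%N, X);
  pr_proj : forall i, is_projective (pr_obj i);
  pr_diff_rhom : forall i, is_rhom (pr_diff i);
  pr_aug_rhom : is_rhom pr_aug;
  pr_aug_surj : limg pr_aug = fullv;
  pr_exact0 : limg (pr_diff 0) = lker pr_aug;
  pr_exact : forall i, limg (pr_diff i.+1) = lker (pr_diff i)
}.

(* The complex Hom_A(P, Y), whose cohomology is Ext_A(X, Y). *)
Definition ext_cocycle X (P : proj_resolution X) Y j (f : 'Hom(P j, Y)) :=
  is_rhom f /\ (f \o pr_diff P j)%VF = 0.

Definition ext_coboundary X (P : proj_resolution X) Y j :
    'Hom(P j, Y) -> Prop :=
  match j with
  | 0%N => fun f => f = 0
  | i.+1 => fun f =>
      exists2 g : 'Hom(P i, Y), is_rhom g & f = (g \o pr_diff P i)%VF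
  end.

(* Ext^j_A(X, Y) = 0. The cohomology does not depend on the projective
   resolution, and every X has one. *)
Definition ext_vanishes j X Y :=
  forall (P : proj_resolution X) (f : 'Hom(P j, Y)),
    ext_cocycle f -> ext_coboundary f.

Definition ext_perp (r : nat) (C D : rmodule A -> Prop) :=
  forall X Y, C X -> D Y ->
  forall j, (1 <= j <= r)%N -> ext_vanishes j X Y.

Definition o_ (k : nat) : \bar int :=
  supremum 0%E [set s | exists2 M,
    ext_perp k (in_add M) (in_add M) & s = size_mod M].

(* 0 -> M -> ir_obj 0 -> ir_obj 1 -> ...; minimality says that ir_obj 0 is an
   injective envelope of M and ir_obj i.+1 one of the i-th cosyzygy. *)
Record min_inj_resolution M := MinInjResolution {
  ir_obj :> nat -> rmodule A;
  ir_diff : forall i, 'Hom(ir_obj i, ir_obj i.+1);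
  ir_aug : 'Hom(M, ir_obj 0%N);
  ir_inj : forall i, is_injective (ir_obj i);
  ir_diff_rhom : forall i, is_rhom (ir_diff i);
  ir_aug_rhom : is_rhom ir_aug;
  ir_aug_inj : lker ir_aug = 0%VS;
  ir_exact0 : limg ir_aug = lker (ir_diff 0);
  ir_exact : forall i, limg (ir_diff i) = lker (ir_diff i.+1);
  ir_min0 : is_essential (limg ir_aug);
  ir_min : forall i, is_essential (limg (ir_diff i))
}.

Definition domdim_res M (I : min_inj_resolution M) : \bar int :=
  if `[< is_projective (I 0%N) >] then
    (supremum 0 [set d | exists2 n : nat,
       (forall i, (i <= n)%N -> is_projective (I i)) & d = (n%:Z)%:E] + 1)%E
  else 0%E.

(* The minimal injective resolution of M exists and is unique up to
   isomorphism, so the set below is a singleton. *)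
Definition domdim M : \bar int :=
  xget 0%E [set d | exists I : min_inj_resolution M, d = domdim_res I].

End Modules.

Arguments num_simples {K} A.
Arguments o_ {K} A k.

Section Algebras.
Variables (K : fieldType) (A : falgType K).

(* 1 != 0 is part of falgType. *)
Definition connected_alg :=
  forall e : A, e * e = e -> (forall a, e * a = a * e) -> e = 0 \/ e = 1.

Definition semisimple_alg := is_semisimple (regular A).

Definition selfinjective := is_injective (regular A).

(* A is isomorphic to D(A) = Hom_K(A, K) as a bimodule, where
   (a f b)(y) = f (b y a). *)
Definition symmetric_alg :=
  exists phi : 'Hom(A, 'Hom(A, K^o)), bijective phi /\
    forall a x b y, phi (a * x * b) y = phi x (b * y * a).

Definition is_generator (N : rmodule A) := in_add N (regular A).

End Algebras.

Definition alg_iso_End (K : fieldType) (A B : falgType K) (N : rmodule B) :=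
  exists phi : 'Hom(A, 'End(N)),
    [/\ phi 1 = \1%VF, forall a b, phi (a * b) = (phi a \o phi b)%VF,
        injective phi
      & forall f : 'End(N), is_rhom f <-> exists a, f = phi a].

Definition gendo_symmetric (K : fieldType) (A : falgType K) :=
  exists (B : falgType K) (N : rmodule B),
    [/\ symmetric_alg B, is_generator N & alg_iso_End A N].

(* Main.v *)
From HB Require Import structures.
Require Import Defs.
From mathcomp Require Import all_boot all_order all_algebra all_field.
From mathcomp Require Import boolp classical_sets constructive_ereal.
From mathcomp Require Import zify.

(** Let J 0 = A, let J 1, J 2, ... be the terms of its minimal injective
    resolution, and let C a be the image of J a -> J (a+1), the a-th cosyzygy of
    A. Suppose that J 1, ..., J (r(k+2)) are projective. Then the direct sum M of
    C 0 = A, C (k+2), ..., C (r(k+2)) satisfies Ext^j (M, M) = 0 for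
    j = 1, ..., k, and it has at least w + r indecomposable summands, so that
    o_k(A) is at least w + r ([o_ge_num_simples_add]). If o_k(A) is finite, this
    bounds r, hence the number of projective terms at the beginning of the
    resolution, and the theorem follows. Taking M = A shows that o_k(A) >= w in
    any case, so that the bound is never negative ([o_ge_num_simples]).

    Orthogonality. The coresolution gives Ext^j (C a, C b) = Ext^(j+b) (C a, A)
    ([hom_exact_ext_vanishes]), and shifting along the projective modules J s
    in the first variable leaves two cases ([hom_exact_cosyzygy]). If j + b > a,
    one arrives at Ext^(j+b-a) (A, A) = 0. If j + b < a - 1, one arrives at
    Ext^1 (C t, A) with t >= 3, the cohomology of
    Hom (J t, A) -> Hom (J (t-1), A) -> Hom (J (t-2), A). The terms J (t-1) and
    J (t-2) are projective-injective, and on such modules the functors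
    Hom_A (-, A) and Hom_K (-, K) are isomorphic because A is gendo-symmetric;
    hence this cohomology is dual to that of the exact sequence
    J (t-2) -> J (t-1) -> J t and vanishes ([hom_regular_exact]). The degrees
    j + b = a and j + b = a - 1 do not occur when a and b are multiples of k+2
    and j is between 1 and k.

    The isomorphism between Hom_A (-, A) and the duality comes from
    A = End_B (N) with N a generator over the symmetric algebra B
    ([trace_data]). The symmetrizing form turns a linear form mu on N into a
    B-linear map mu' : N -> B, and y and mu define the element z |-> y mu'(z)
    of A. A linear form xi on a module Q corresponds to the f : Q -> A given by
    mu (f(q) y) = xi (q (y mu')). Projective-injective modules are summands of
    powers of Hom_K (N, K), and for that module the correspondence is a
    bijection.

    Summands. A has at least w indecomposable projective summands, since each
    simple is a quotient of one of them, and of no two non-isomorphic simples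
    by Fitting's lemma ([simple_projective_covers]). For a > 0 no C a in the
    range is projective, since otherwise A would be a summand of an injective
    module; so C a has a nonprojective indecomposable summand
    ([cosyzygy_nonprojective]). A module which is a summand of both C a and C b,
    with a < b, is projective: every C a -> C b lifts to J b because
    Ext^b (C a, A) = Ext^(b-a) (A, A) = 0 ([cosyzygy_common_retract]). *)

Set Implicit Arguments.
Unset Strict Implicit.
Unset Printing Implicit Defensive.

Import Order.TTheory GRing.Theory Num.Theory.
Local Open Scope ring_scope.

(** * Homomorphisms, factorizations and submodules *)

Section LinearMaps.
Variables (K : fieldType) (V W : vectType K) (f : V -> W) (hf : linear f).

Definition lfun_of : 'Hom(V, W) :=
  linfun (HB.pack_for {linear V -> W} f (GRing.isLinear.Build K V W *:%R f hf)).

Lemma lfun_ofE x : lfun_of x = f x.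
Proof. by rewrite lfunE. Qed.

End LinearMaps.

Section Homomorphisms.
Variables (K : fieldType) (A : falgType K).
Implicit Types M N P Q X Y Z : rmodule A.

Lemma ractB M (x y : M) a : ract (x - y) a = ract x a - ract y a.
Proof. by rewrite addrC -scaleN1r ract_linearl scaleN1r addrC. Qed.

Lemma ract0 M a : ract (0 : M) a = 0.
Proof. by rewrite -[X in ract X](subrr 0) ractB subrr. Qed.

Lemma ractD M (x y : M) a : ract (x + y) a = ract x a + ract y a.
Proof. by rewrite -[x in LHS]scale1r ract_linearl scale1r. Qed.

Lemma ractZ M k (x : M) a : ract (k *: x) a = k *: ract x a.
Proof. by rewrite -[k *: x]addr0 ract_linearl ract0 addr0. Qed.

Lemma ract_suml M n (F : 'I_n -> M) a :
  ract (\sum_i F i) a = \sum_i ract (F i) a.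
Proof.
apply: (big_morph (fun x : M => ract x a)); last exact: ract0.
by move=> x y; rewrite ractD.
Qed.

Lemma ractBr M (x : M) a b : ract x (a - b) = ract x a - ract x b.
Proof. by rewrite addrC -scaleN1r ract_linearr scaleN1r addrC. Qed.

Lemma ractr0 M (x : M) : ract x 0 = 0.
Proof. by rewrite -[X in ract _ X](subrr 0) ractBr subrr. Qed.

Lemma ractDr M (x : M) a b : ract x (a + b) = ract x a + ract x b.
Proof. by rewrite -[a in LHS]scale1r ract_linearr scale1r. Qed.

Lemma ract_sumr M (x : M) n (F : 'I_n -> A) :
  ract x (\sum_i F i) = \sum_i ract x (F i).
Proof.
apply: (big_morph (ract x)); last exact: ractr0.
by move=> a b; rewrite ractDr.
Qed.

Lemma rhom_id M : is_rhom (\1%VF : 'Hom(M, M)).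
Proof. by move=> x a; rewrite !id_lfunE. Qed.

Lemma rhom0 M N : is_rhom (0 : 'Hom(M, N)).
Proof. by move=> x a; rewrite !zero_lfunE ract0. Qed.

Lemma rhom_comp X Y Z (g : 'Hom(Y, Z)) (f : 'Hom(X, Y)) :
  is_rhom g -> is_rhom f -> is_rhom (g \o f)%VF.
Proof. by move=> hg hf x a; rewrite !comp_lfunE hf hg. Qed.

Lemma rhomB M N (f g : 'Hom(M, N)) : is_rhom f -> is_rhom g -> is_rhom (f - g).
Proof.
by move=> hf hg x a; rewrite !add_lfunE !opp_lfunE hf hg ractB.
Qed.

Lemma rhomD M N (f g : 'Hom(M, N)) : is_rhom f -> is_rhom g -> is_rhom (f + g).
Proof. by move=> hf hg x a; rewrite !add_lfunE hf hg ractD. Qed.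

Lemma limg_fullP (V W : vectType K) (f : 'Hom(V, W)) :
  limg f = fullv <-> forall y, exists x, y = f x.
Proof.
split=> [E y | S].
  have /memv_imgP[x _ ->]: y \in limg f by rewrite E memvf.
  by exists x.
apply/vspaceP=> y; rewrite memvf; have [x ->] := S y.
exact: memv_img (memvf _).
Qed.

Lemma lker_zeroP (V W : vectType K) (f : 'Hom(V, W)) :
  lker f = 0%VS <-> forall x, f x = 0 -> x = 0.
Proof.
split=> [E x fx | I]; first by apply/eqP; rewrite -memv0 -E memv_ker fx.
apply/vspaceP=> x; rewrite memv0 memv_ker.
by apply/eqP/eqP => [/I|->]; rewrite ?linear0.
Qed.

Lemma limg_lkerP (U V W : vectType K) (f : 'Hom(U, V)) (g : 'Hom(V, W)) :
  limg f = lker g ->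
  (forall x, g (f x) = 0) /\ (forall y, g y = 0 -> exists x, y = f x).
Proof.
move=> E; split=> [x | y gy].
  by apply/eqP; rewrite -memv_ker -E memv_img ?memvf.
have /memv_imgP[x _ ->]: y \in limg f by rewrite E memv_ker gy.
by exists x.
Qed.

Lemma lfun_inj (V W : vectType K) (f : 'Hom(V, W)) :
  (forall x, f x = 0 -> x = 0) -> injective f.
Proof. by move/lker_zeroP/eqP/lker0P. Qed.

(** Linear factorizations through an injection or a surjection are
    automatically homomorphisms. *)
Lemma factor_mono X Y Z (i : 'Hom(Y, Z)) (f : 'Hom(X, Z)) :
  is_rhom i -> is_rhom f -> (forall y, i y = 0 -> y = 0) ->
  (forall x, exists y, f x = i y) ->
  exists2 g : 'Hom(X, Y), is_rhom g & forall x, f x = i (g x).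
Proof.
move=> hi hf inj im; pose g := (i^-1 \o f)%VF.
have E x : f x = i (g x).
  rewrite comp_lfunE limg_lfunVK //; have [y ->] := im x.
  exact: memv_img (memvf _).
exists g => // x a; apply: (lfun_inj inj).
by rewrite hi -!E hf.
Qed.

Lemma factor_epi X Y Z (p : 'Hom(X, Y)) (f : 'Hom(X, Z)) :
  is_rhom p -> is_rhom f -> (forall y, exists x, y = p x) ->
  (forall x, p x = 0 -> f x = 0) ->
  exists2 g : 'Hom(Y, Z), is_rhom g & forall x, f x = g (p x).
Proof.
move=> hp hf surj ker; pose g := (f \o p^-1)%VF.
have E x : f x = g (p x).
  rewrite comp_lfunE; apply/eqP; rewrite -subr_eq0 -raddfB; apply/eqP/ker.
  rewrite raddfB /= limg_lfunVK ?subrr //.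
  exact: memv_img (memvf _).
exists g => // y a; have [x ->] := surj y.
by rewrite -hp -!E hf.
Qed.

Lemma bij_riso X Y (f : 'Hom(X, Y)) :
  is_rhom f -> (forall x, f x = 0 -> x = 0) -> (forall y, exists x, y = f x) ->
  riso X Y.
Proof.
move=> hf inj surj; exists f => //; exists f^-1%VF.
  by apply: lker0_lfunK; apply/eqP/lker_zeroP.
move=> y; apply: limg_lfunVK; have [x ->] := surj y.
exact: memv_img (memvf _).
Qed.

Lemma riso_inverse X Y : riso X Y ->
  exists f : 'Hom(X, Y), exists g : 'Hom(Y, X),
  [/\ is_rhom f, is_rhom g, cancel f g & cancel g f].
Proof.
case=> f hf [g fK gK]; have kf: lker f == 0%VS by apply/lker0P/(can_inj fK).
have E: g =1 f^-1%VF.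
  by move=> y; rewrite -{2}[y]gK lker0_lfunK.
exists f, f^-1%VF; split=> //.
- by move=> y a; rewrite -!E -{1}[y]gK -hf fK.
- by move=> x; rewrite -E fK.
- by move=> y; rewrite -E gK.
Qed.

Lemma riso_sym X Y : riso X Y -> riso Y X.
Proof. by case/riso_inverse=> f [g [hf hg fK gK]]; exists g => //; exists f. Qed.

Lemma riso_refl X : riso X X.
Proof.
exists \1%VF; first exact: rhom_id.
by exists \1%VF => x; rewrite !id_lfunE.
Qed.

Section Submodule.
Variables (M : rmodule A) (U : {vspace M}) (hU : is_submod U).

Definition submod_act (x : subvs_of U) (a : A) : subvs_of U :=
  vsproj U (ract (vsval x) a).

Lemma submod_actE x a : vsval (submod_act x a) = ract (vsval x) a.
Proof. by rewrite vsprojK //; apply: hU; apply: subvsP. Qed.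

Fact submod_linearl a : linear (submod_act^~ a).
Proof.
move=> k x y; apply: subvs_inj.
by rewrite submod_actE !linearP /= ract_linearl !submod_actE.
Qed.

Fact submod_linearr x : linear (submod_act x).
Proof.
move=> k a b; apply: subvs_inj.
by rewrite submod_actE linearP /= ract_linearr !submod_actE.
Qed.

Fact submod_act1 x : submod_act x 1 = x.
Proof. by apply: subvs_inj; rewrite submod_actE ract1. Qed.

Fact submod_actM x a b : submod_act x (a * b) = submod_act (submod_act x a) b.
Proof. by apply: subvs_inj; rewrite !submod_actE ractM. Qed.

Definition submod : rmodule A :=
  RModule submod_linearl submod_linearr submod_act1 submod_actM.

Definition submod_incl : 'Hom(submod, M) := linfun (@vsval K M U).

Lemma submod_inclE x : submod_incl x = vsval x.
Proof. by rewrite lfunE. Qed.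

Lemma rhom_submod_incl : is_rhom submod_incl.
Proof. by move=> x a; rewrite !submod_inclE submod_actE. Qed.

Lemma submod_incl_inj x : submod_incl x = 0 -> x = 0.
Proof. by rewrite submod_inclE => E; apply: subvs_inj; rewrite E linear0. Qed.

Lemma submod_inclP y : y \in U <-> exists x, y = submod_incl x.
Proof.
split=> [Uy | [x ->]]; last by rewrite submod_inclE subvsP.
by exists (vsproj U y); rewrite submod_inclE vsprojK.
Qed.

Lemma submod_incl_mem x : submod_incl x \in U.
Proof. by apply/submod_inclP; exists x. Qed.

End Submodule.

Lemma is_submod_limg M N (f : 'Hom(M, N)) : is_rhom f -> is_submod (limg f).
Proof.
by move=> hf y a /memv_imgP[x _ ->]; rewrite -hf memv_img ?memvf.
Qed.

Lemma is_submod_lker M N (f : 'Hom(M, N)) : is_rhom f -> is_submod (lker f).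
Proof.
by move=> hf x a; rewrite !memv_ker hf => /eqP ->; rewrite ract0.
Qed.

Lemma image_factorization M N (f : 'Hom(M, N)) : is_rhom f ->
  exists C : rmodule A, exists p : 'Hom(M, C), exists i : 'Hom(C, N),
  [/\ is_rhom p, is_rhom i, forall c, exists x, c = p x,
      forall c, i c = 0 -> c = 0 & forall x, f x = i (p x)].
Proof.
move=> hf; pose hU := is_submod_limg hf.
have hi := @rhom_submod_incl _ _ hU.
have [|p hp fE] := factor_mono hi hf (@submod_incl_inj _ _ hU).
  by move=> x; apply/(submod_inclP hU); rewrite memv_img ?memvf.
exists (submod hU), p, (submod_incl hU); split=> //; last exact: submod_incl_inj.
move=> c; have /memv_imgP[x _ E] := submod_incl_mem c.
by exists x; apply: (lfun_inj (@submod_incl_inj _ _ hU)); rewrite E fE.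
Qed.

(** * Projective and injective modules, retracts *)

(** Direct summands without a chosen complement: unlike is_summand, this
    relation composes, and it carries factorizations of homomorphisms from Y
    to X. *)
Definition is_retract X Y :=
  exists u : 'Hom(X, Y), exists v : 'Hom(Y, X),
  [/\ is_rhom u, is_rhom v & forall x, v (u x) = x].

Lemma riso_retract X Y : riso X Y -> is_retract X Y.
Proof. by case/riso_inverse=> f [g [hf hg fK _]]; exists f, g; split. Qed.

Lemma retract_trans X Y Z : is_retract X Y -> is_retract Y Z -> is_retract X Z.
Proof.
case=> u [v [hu hv vu]] [u' [v' [hu' hv' vu']]].
exists (u' \o u)%VF, (v \o v')%VF; split; try exact: rhom_comp.
by move=> x; rewrite !comp_lfunE vu' vu.
Qed.

(** Lifting along a homomorphism which need not be surjective, as long as the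
    image of f lies in its image; this is the form met in exact sequences. *)
Lemma projective_lift P Y Z (g : 'Hom(Y, Z)) (f : 'Hom(P, Z)) :
  is_projective P -> is_rhom g -> is_rhom f ->
  (forall x, exists y, f x = g y) ->
  exists2 h : 'Hom(P, Y), is_rhom h & forall x, f x = g (h x).
Proof.
move=> projP hg hf im.
have [C [p [i [hp hi ps ii gE]]]] := image_factorization hg.
have [|f' hf' fE] := factor_mono hi hf ii.
  by move=> x; have [y ->] := im x; exists (p y); rewrite gE.
have [|h hh f'E] := projP _ _ p f' hp hf'; first by apply/limg_fullP.
by exists h => // x; rewrite fE gE f'E comp_lfunE.
Qed.

Lemma injective_extend Q X Y (g : 'Hom(X, Y)) (f : 'Hom(X, Q)) :
  is_injective Q -> is_rhom g -> is_rhom f ->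
  (forall x, g x = 0 -> f x = 0) ->
  exists2 h : 'Hom(Y, Q), is_rhom h & forall x, f x = h (g x).
Proof.
move=> injQ hg hf ker.
have [C [p [i [hp hi ps ii gE]]]] := image_factorization hg.
have [|f' hf' fE] := factor_epi hp hf ps.
  by move=> x px; apply: ker; rewrite gE px linear0.
have [|h hh f'E] := injQ _ _ i f' hi hf'; first by apply/lker_zeroP.
by exists h => // x; rewrite fE gE f'E comp_lfunE.
Qed.

Lemma retract_projective X Y :
  is_retract X Y -> is_projective Y -> is_projective X.
Proof.
case=> u [v [hu hv vu]] projY Z W g f hg hf sg.
have [h hh E] := projY _ _ g (f \o v)%VF hg (rhom_comp hf hv) sg.
exists (h \o u)%VF; first exact: rhom_comp.
apply/lfunP=> x; have := congr1 (fun F : 'Hom(Y, W) => F (u x)) E.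
by rewrite !comp_lfunE vu.
Qed.

Lemma retract_injective X Y :
  is_retract X Y -> is_injective Y -> is_injective X.
Proof.
case=> u [v [hu hv vu]] injY Z W g f hg hf sg.
have [h hh E] := injY _ _ g (u \o f)%VF hg (rhom_comp hu hf) sg.
exists (v \o h)%VF; first exact: rhom_comp.
apply/lfunP=> x; have := congr1 (fun F : 'Hom(Z, Y) => v (F x)) E.
by rewrite !comp_lfunE vu.
Qed.

Lemma split_epi P X (p : 'Hom(X, P)) :
  is_projective P -> is_rhom p -> (forall y, exists x, y = p x) ->
  exists2 s : 'Hom(P, X), is_rhom s & forall y, p (s y) = y.
Proof.
move=> projP hp ps; have [|s hs E] := projective_lift projP hp (@rhom_id P).
  by move=> x; rewrite id_lfunE; have [y] := ps x; exists y.
by exists s => // y; rewrite -E id_lfunE.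
Qed.

Lemma split_mono Q X (i : 'Hom(Q, X)) :
  is_injective Q -> is_rhom i -> (forall x, i x = 0 -> x = 0) ->
  exists2 r : 'Hom(X, Q), is_rhom r & forall x, r (i x) = x.
Proof.
move=> injQ hi ii; have [|r hr E] := injective_extend injQ hi (@rhom_id Q).
  by move=> x /ii ->; rewrite linear0.
by exists r => // x; rewrite -E id_lfunE.
Qed.

Definition orbit_map M (x : M) : 'Hom(regular A, M) :=
  lfun_of (ract_linearr x).

Lemma orbit_mapE M (x : M) a : orbit_map x a = ract x a.
Proof. exact: lfun_ofE. Qed.

Lemma rhom_orbit_map M (x : M) : is_rhom (orbit_map x).
Proof. by move=> a b; rewrite !orbit_mapE ractM. Qed.

Lemma regular_projective : is_projective (regular A).
Proof.
move=> X Y g f hg hf /limg_fullP sg; have [x E] := sg (f 1).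
exists (orbit_map x); first exact: rhom_orbit_map.
apply/lfunP=> a; rewrite comp_lfunE orbit_mapE hg -E -hf.
by congr (f _); rewrite /= mul1r.
Qed.

End Homomorphisms.

(** * Ext computed from an injective coresolution *)

Lemma comp_lfun0 (K : fieldType) (U V W : vectType K) (g : 'Hom(V, W))
    (f : 'Hom(U, V)) : (g \o f)%VF = 0 -> forall x, g (f x) = 0.
Proof. by move=> E x; rewrite -comp_lfunE E zero_lfunE. Qed.

Section Coresolution.
Variables (K : fieldType) (A : falgType K).
Variables (J : nat -> rmodule A) (D : forall s, 'Hom(J s, J s.+1)).
Hypothesis rhom_D : forall s, is_rhom (D s).
Hypothesis exactD : forall s y, D s.+1 y = 0 <-> exists x, y = D s x.
Hypothesis injJ : forall s, is_injective (J s.+1).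
Variables (C : nat -> rmodule A).
Variables (p : forall s, 'Hom(J s, C s)) (i : forall s, 'Hom(C s, J s.+1)).
Hypothesis rhom_p : forall s, is_rhom (p s).
Hypothesis rhom_i : forall s, is_rhom (i s).
Hypothesis p_surj : forall s y, exists x, y = p s x.
Hypothesis i_inj : forall s x, i s x = 0 -> x = 0.
Hypothesis Dpi : forall s x, D s x = i s (p s x).
Implicit Types X : rmodule A.

(** Vanishing of the n-th cohomology of Hom (X, J). Here J 0 is the module which
    is coresolved and J (n+1) is its n-th injective term, so that for positive n
    this says that Ext^n (X, J 0) = 0. Unlike ext_vanishes, it is visibly
    additive in X. *)
Definition hom_exact X n := forall g : 'Hom(X, J n.+1),
  is_rhom g -> (forall x, D n.+1 (g x) = 0) ->
  exists2 g' : 'Hom(X, J n), is_rhom g' & forall x, g x = D n (g' x).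

Lemma Di s c : D s.+1 (i s c) = 0.
Proof. by have [x ->] := p_surj c; apply/exactD; exists x. Qed.

Lemma p_eq0 s x : D s x = 0 -> p s x = 0.
Proof. by rewrite Dpi => /i_inj. Qed.

Lemma lift_i X s (g : 'Hom(X, J s.+1)) :
  is_rhom g -> (forall x, D s.+1 (g x) = 0) ->
  exists2 g' : 'Hom(X, C s), is_rhom g' & forall x, g x = i s (g' x).
Proof.
move=> hg Dg; apply: factor_mono => // [y | x]; first exact: i_inj.
by have [y E] := (exactD _).1 (Dg x); exists (p s y); rewrite E Dpi.
Qed.

(** Ext^(j+1) (X, C b) = Ext^(j+1+b) (X, J 0), where the left-hand side is
    computed from a projective resolution P of X and the right-hand side from
    J. Since J (b+1) is injective, a cocycle P (j+1) -> C b, seen in J (b+1),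
    extends along P (j+1) -> P j; composing the extension with
    J (b+1) -> C (b+1) gives a cocycle P j -> C (b+1) to which induction
    applies. *)
Lemma hom_exact_ext_vanishes X j b :
  hom_exact X (j + b).+1 -> ext_vanishes j.+1 X (C b).
Proof.
elim: j b => [|j IHj] b HE P f [hf /comp_lfun0 fd].
  have [_ ex1] := limg_lkerP (pr_exact P 0).
  have [dd0 ex0] := limg_lkerP (pr_exact0 P).
  have augS := (limg_fullP _).1 (pr_aug_surj P).
  have [x /ex1[y ->]|h hh hE] := injective_extend (injJ (s := b))
      (@pr_diff_rhom _ _ _ P 0) (rhom_comp (@rhom_i b) hf).
    by rewrite comp_lfunE fd linear0.
  have {}hE x : i b (f x) = h (pr_diff P 0 x) by rewrite -hE comp_lfunE.
  have [x /ex0[y ->]|g hg gE] := factor_epi (@pr_aug_rhom _ _ _ P)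
      (rhom_comp (@rhom_D b.+1) hh) augS.
    by rewrite comp_lfunE -hE Di.
  have {}gE x : D b.+1 (h x) = g (pr_aug P x) by rewrite -gE comp_lfunE.
  have [x|g' hg' g'E] := HE _ hg.
    by have [y ->] := augS x; rewrite -gE; apply/exactD; exists (h y).
  have [||e he eE] := @lift_i (P 0%N) b (h - (g' \o pr_aug P)%VF).
  - exact/(rhomB hh)/rhom_comp/pr_aug_rhom.
  - by move=> x; rewrite add_lfunE opp_lfunE comp_lfunE raddfB /= gE g'E subrr.
  exists e => //; apply/lfunP=> x; rewrite comp_lfunE.
  apply: (lfun_inj (@i_inj b)).
  by rewrite -eE add_lfunE opp_lfunE comp_lfunE dd0 linear0 subr0.
have [_ ex1] := limg_lkerP (pr_exact P j.+1).
have [dd0 ex0] := limg_lkerP (pr_exact P j).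
have [x /ex1[y ->]|h hh hE] := injective_extend (injJ (s := b))
    (@pr_diff_rhom _ _ _ P j.+1) (rhom_comp (@rhom_i b) hf).
  by rewrite comp_lfunE fd linear0.
have {}hE x : i b (f x) = h (pr_diff P j.+1 x) by rewrite -hE comp_lfunE.
have [||g hg gE] := IHj b.+1 _ P (p b.+1 \o h)%VF.
- by rewrite addnS.
- split; first exact: rhom_comp.
  by apply/lfunP=> x; rewrite !comp_lfunE zero_lfunE -hE p_eq0 ?Di.
have [x|g' hg' g'E] := projective_lift (@pr_proj _ _ _ P j) (@rhom_p b.+1) hg.
  exact: p_surj.
have [||e he eE] := @lift_i (P j.+1) b (h - (g' \o pr_diff P j)%VF).
- exact/(rhomB hh)/rhom_comp/pr_diff_rhom.
- move=> x; rewrite add_lfunE opp_lfunE comp_lfunE raddfB /= !Dpi -raddfB /=.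
  by rewrite -g'E -[p _ (h x)]comp_lfunE gE comp_lfunE subrr linear0.
exists e => //; apply/lfunP=> x; rewrite comp_lfunE.
apply: (lfun_inj (@i_inj b)).
by rewrite -eE add_lfunE opp_lfunE comp_lfunE dd0 linear0 subr0.
Qed.

(** Dimension shifting in the first variable, along
    0 -> C a -> J (a+1) -> C (a+1) -> 0. *)
Lemma hom_exact_shift a n : is_projective (J a.+1) ->
  hom_exact (C a) n.+1 -> hom_exact (C a.+1) n.+2.
Proof.
move=> projJ HE f hf Df.
have [x|h hh hE] := projective_lift projJ (@rhom_D n.+2) (rhom_comp hf (@rhom_p a.+1)).
  by rewrite comp_lfunE; apply/exactD; apply: Df.
have {}hE x : f (p a.+1 x) = D n.+2 (h x) by rewrite -hE comp_lfunE.
have [|x|g hg gE] := HE (h \o i a)%VF; first exact: rhom_comp.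
  by rewrite comp_lfunE -hE p_eq0 ?Di ?linear0.
have {}gE x : h (i a x) = D n.+1 (g x) by rewrite -gE comp_lfunE.
have [x /i_inj ->|e he eE] := injective_extend (injJ (s := n)) (@rhom_i a) hg.
  by rewrite linear0.
pose h' := (h - (D n.+1 \o e))%VF.
have hh' : is_rhom h' by apply/(rhomB hh)/rhom_comp.
have [x|g' hg' g'E] := factor_epi (@rhom_p a.+1) hh' (@p_surj a.+1).
  move=> px; have /exactD[y ->] : D a.+1 x = 0 by rewrite Dpi px linear0.
  by rewrite Dpi add_lfunE opp_lfunE comp_lfunE gE -eE subrr.
exists g' => // c; have [x ->] := p_surj c.
rewrite hE -g'E add_lfunE opp_lfunE comp_lfunE raddfB /=.
suff -> : D n.+2 (D n.+1 (e x)) = 0 by rewrite subr0.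
by apply/exactD; exists (e x).
Qed.

(** A homomorphism C a -> J 0 is given as one on J a that vanishes on the kernel
    of p a, so that the last hypothesis lets it extend along C a -> J (a+1).
    Since J (a+1) is projective, this is what Ext^1 (C (a+1), J 0) = 0 means. *)
Lemma hom_exact_one a : is_projective (J a.+1) ->
  (forall x, D 0 x = 0 -> x = 0) ->
  (forall f : 'Hom(J a, J 0%N), is_rhom f -> (forall x, p a x = 0 -> f x = 0) ->
    exists2 f' : 'Hom(J a.+1, J 0%N), is_rhom f' & forall x, f x = f' (D a x)) ->
  hom_exact (C a.+1) 1.
Proof.
move=> projJ inj0 ext0 f hf Df.
have [x|h hh hE] := projective_lift projJ (@rhom_D 1) (rhom_comp hf (@rhom_p a.+1)).
  by rewrite comp_lfunE; apply/exactD; apply: Df.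
have {}hE x : f (p a.+1 x) = D 1 (h x) by rewrite -hE comp_lfunE.
have [||x|g hg gE] := factor_mono (@rhom_D 0) (f := (h \o D a)%VF).
- exact: rhom_comp.
- exact: inj0.
- rewrite comp_lfunE; apply/exactD; rewrite -hE Dpi p_eq0 ?Di ?linear0 //.
have {}gE x : h (D a x) = D 0 (g x) by rewrite -gE comp_lfunE.
have [x px|e he eE] := ext0 g hg.
  by apply: inj0; rewrite -gE Dpi px !linear0.
pose h' := (h - (D 0 \o e))%VF.
have hh' : is_rhom h' by apply/(rhomB hh)/rhom_comp.
have [x|g' hg' g'E] := factor_epi (@rhom_p a.+1) hh' (@p_surj a.+1).
  move=> px; have /exactD[y ->] : D a.+1 x = 0 by rewrite Dpi px linear0.
  by rewrite add_lfunE opp_lfunE comp_lfunE gE -eE subrr.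
exists g' => // c; have [x ->] := p_surj c.
rewrite hE -g'E add_lfunE opp_lfunE comp_lfunE raddfB /=.
suff -> : D 1 (D 0 (e x)) = 0 by rewrite subr0.
by apply/exactD; exists (e x).
Qed.

Lemma hom_exact_projective X n : is_projective X -> hom_exact X n.
Proof.
move=> projX g hg Dg; apply: projective_lift => // x.
by apply/exactD; apply: Dg.
Qed.

Lemma riso_C0 : (forall x, D 0 x = 0 -> x = 0) -> riso (J 0%N) (C 0%N).
Proof.
move=> inj0; apply: (bij_riso (@rhom_p 0)); last exact: p_surj.
by move=> x px; apply: inj0; rewrite Dpi px linear0.
Qed.

(** If n > a, shifting a times leads to Ext^(n-a) (J 0, J 0), which vanishes
    since J 0 is projective. If n < a - 1, shifting n - 1 times leads to
    Ext^1 (C (a-n+1), J 0) with a - n + 1 at least 3, which is where the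
    extension hypothesis is used. *)
Lemma hom_exact_cosyzygy N a n :
  (forall s, (s <= N)%N -> is_projective (J s)) ->
  (forall x, D 0 x = 0 -> x = 0) ->
  (forall a, (2 <= a < N)%N -> forall f : 'Hom(J a, J 0%N), is_rhom f ->
    (forall x, p a x = 0 -> f x = 0) ->
    exists2 f' : 'Hom(J a.+1, J 0%N), is_rhom f' & forall x, f x = f' (D a x)) ->
  (a <= N)%N -> (0 < n)%N -> n != a -> n.+1 != a -> hom_exact (C a) n.
Proof.
move=> projJ inj0 ext0; elim: a n => [|a IHa] [|n] // leN _ na nSa.
  apply: hom_exact_projective.
  have [u [v [hu hv uv vu]]] := riso_inverse (riso_C0 inj0).
  by apply: (retract_projective _ (projJ 0%N isT)); exists v, u; split.
case: n => [|n] in na nSa *.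
  apply: hom_exact_one => //; first exact: projJ.
  apply: ext0; rewrite leN andbT.
  by case: a na nSa {IHa leN} => [|[|a]].
apply: hom_exact_shift; first exact: projJ.
by apply: IHa; rewrite // ltnW.
Qed.

(** A projective cosyzygy splits off the projective-injective module which
    covers it, and so makes the preceding cosyzygy a summand of that module. *)
Lemma cosyzygy_projective_back a : is_projective (J a.+1) ->
  is_projective (C a.+1) -> is_projective (C a) /\ is_injective (C a).
Proof.
move=> projJ projC.
have [s hs ps] := split_epi projC (@rhom_p a.+1) (@p_surj a.+1).
pose e := (\1 - (s \o p a.+1))%VF : 'Hom(J a.+1, J a.+1).
have he : is_rhom e by apply/(rhomB (@rhom_id _ _ _))/rhom_comp.
have [|r hr rE] := @lift_i (J a.+1) a e he.
  move=> x; rewrite add_lfunE opp_lfunE comp_lfunE id_lfunE raddfB /= !Dpi.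
  by rewrite ps subrr.
have R : is_retract (C a) (J a.+1).
  exists (i a), r; split=> // c; apply: (lfun_inj (@i_inj a)).
  rewrite -rE add_lfunE opp_lfunE comp_lfunE id_lfunE.
  by rewrite p_eq0 ?Di // linear0 subr0.
by split; [exact: retract_projective R projJ | exact: retract_injective R _].
Qed.

Lemma cosyzygy_nonprojective a :
  (forall s, (s <= a.+1)%N -> is_projective (J s)) ->
  (forall x, D 0 x = 0 -> x = 0) ->
  ~ is_injective (J 0%N) -> ~ is_projective (C a.+1).
Proof.
move=> projJ inj0 ninj; elim: a projJ => [|a IHa] projJ projC.
  have [_ injC] := cosyzygy_projective_back (projJ 1%N isT) projC.
  exact/ninj/(retract_injective (riso_retract (riso_C0 inj0))).
have [projC' _] := cosyzygy_projective_back (projJ _ (leqnn _)) projC.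
by apply: IHa projC' => s les; apply: projJ; apply: leqW.
Qed.

(** Since Ext^b (C a, J 0) = 0, every homomorphism C a -> C b factors through
    J b; so does the identity of X. *)
Lemma cosyzygy_common_retract X a b : hom_exact (C a) b ->
  is_projective (J b) -> is_retract X (C a) -> is_retract X (C b) ->
  is_projective X.
Proof.
move=> HE projJ [u [v [hu hv vu]]] [u' [v' [hu' hv' vu']]].
have [x|g hg gE] := HE (i b \o (u' \o v))%VF (rhom_comp (@rhom_i b) (rhom_comp hu' hv)).
  by rewrite comp_lfunE Di.
apply: (retract_projective _ projJ).
exists (g \o u)%VF, (v' \o p b)%VF; split; try exact: rhom_comp.
move=> x; rewrite !comp_lfunE.
suff -> : p b (g (u x)) = u' x by rewrite vu'.
apply: (lfun_inj (@i_inj b)).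
by rewrite -Dpi -gE !comp_lfunE vu.
Qed.

End Coresolution.

(** * The trace pairing of a gendo-symmetric algebra *)

(** What remains of an isomorphism A = End_B (N), for a generator N over a
    symmetric algebra B, once B is forgotten. The form of B identifies
    Hom_K (N, K) with Hom_B (N, B), and [td_tr y mu] is the endomorphism
    z |-> y mu'(z) of N, where mu' : N -> B corresponds to mu; these
    endomorphisms span the maps that factor through projective B-modules.
    The field [td_sym] is the symmetry of B, [td_unit] says that N is a
    generator, and [td_dense] that an endomorphism of N is B-linear as soon as
    it commutes with the traces. *)
Record trace_data (K : fieldType) (A : falgType K) := TraceData {
  td_mod : vectType K;
  td_act : 'Hom(A, 'End(td_mod));
  td_tr : td_mod -> 'Hom(td_mod, K^o) -> A;
  td_size : nat;
  td_vec : 'I_td_size -> td_mod;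
  td_form : 'I_td_size -> 'Hom(td_mod, K^o);
  td_act1 : td_act 1 = \1%VF;
  td_actM : forall a b, td_act (a * b) = (td_act a \o td_act b)%VF;
  td_act_inj : injective td_act;
  td_tr_linearl : forall mu, linear (td_tr^~ mu);
  td_tr_linearr : forall y, linear (td_tr y);
  td_trMl : forall c y mu, td_tr (td_act c y) mu = c * td_tr y mu;
  td_trMr : forall c y mu, td_tr y (mu \o td_act c)%VF = td_tr y mu * c;
  td_sym : forall y nu z (mu : 'Hom(td_mod, K^o)),
    mu (td_act (td_tr y nu) z) = nu (td_act (td_tr z mu) y);
  td_unit : forall y, \sum_i td_act (td_tr y (td_form i)) (td_vec i) = y;
  td_dense : forall g : 'End(td_mod),
    (forall y (mu : 'Hom(td_mod, K^o)) z,
      g (td_act (td_tr y mu) z) = td_act (td_tr (g y) mu) z) ->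
    exists c, g = td_act c
}.

Lemma lfun_sep (K : fieldType) (V : vectType K) (x : V) :
  (forall mu : 'Hom(V, K^o), mu x = 0) -> x = 0.
Proof.
move=> H; rewrite (coord_vbasis (memvf x)) big1 // => i _.
suff -> : coord (vbasis {:V}) i x = 0 by rewrite scale0r.
by rewrite -[LHS](lfunE (coord (vbasis {:V}) i : {linear V -> K^o})) H.
Qed.

Section Symmetric.
Variables (K : fieldType) (B : falgType K) (psi : 'Hom(B, 'Hom(B, K^o))).
Hypothesis psi_bij : bijective psi.
Hypothesis psi_act : forall a x b y, psi (a * x * b) y = psi x (b * y * a).

Lemma psi_mul x y : psi x y = psi 1 (x * y).
Proof. by have := psi_act 1 1 x y; rewrite !mul1r mulr1. Qed.

Lemma psi_sym x y : psi 1 (x * y) = psi 1 (y * x).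
Proof. by have := psi_act x 1 1 y; rewrite !mulr1 mul1r psi_mul. Qed.

Lemma psi_nondeg x y : (forall b, psi 1 (x * b) = psi 1 (y * b)) -> x = y.
Proof.
move=> E; apply: (bij_inj psi_bij); apply/lfunP=> b.
by rewrite psi_mul E -psi_mul.
Qed.

Lemma psi_repr (f : 'Hom(B, K^o)) : exists x, forall b, psi 1 (x * b) = f b.
Proof.
have [g _ gK] := psi_bij; exists (g f) => b.
by rewrite -psi_mul gK.
Qed.

Variable N : rmodule B.

(** Hom_K (N, K) = Hom_B (N, B), through the symmetrizing form of B. *)
Lemma dual_lift : exists t : 'Hom(N, K^o) -> N -> B,
  forall (mu : 'Hom(N, K^o)) y b, psi 1 (t mu y * b) = mu (ract y b).
Proof.
have H (u : 'Hom(N, K^o) * N) :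
    exists x, forall b, psi 1 (x * b) = u.1 (ract u.2 b).
  have [x E] := psi_repr (u.1 \o orbit_map u.2)%VF.
  by exists x => b; rewrite E comp_lfunE orbit_mapE.
have [t tE] := choice H.
by exists (fun mu y => t (mu, y)) => mu y b; apply: tE.
Qed.

Variables (t : 'Hom(N, K^o) -> N -> B).
Hypothesis tE : forall (mu : 'Hom(N, K^o)) y b, psi 1 (t mu y * b) = mu (ract y b).

Lemma t_linearr mu : linear (t mu).
Proof.
move=> k x y; apply: psi_nondeg => b.
rewrite tE mulrDl linearD /= -scalerAl !linearZ /= !tE.
by rewrite ractD ractZ linearD linearZ.
Qed.

Lemma t_linearl y : linear (t^~ y).
Proof.
move=> k mu nu; apply: psi_nondeg => b.
rewrite tE mulrDl linearD /= -scalerAl !linearZ /= !tE.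
by rewrite add_lfunE scale_lfunE.
Qed.

Lemma tM mu y b : t mu (ract y b) = t mu y * b.
Proof. by apply: psi_nondeg => c; rewrite -mulrA !tE ractM. Qed.

End Symmetric.

(** The trace ideal of a generator is the whole algebra. *)
Lemma generator_unit (K : fieldType) (B : falgType K) (N : rmodule B) :
  is_generator N ->
  exists n (x : 'I_n -> N) (f : 'I_n -> 'Hom(N, regular B)),
    (forall i, is_rhom (f i)) /\ \sum_i (f i (x i) : B) = 1.
Proof.
case=> n _ [Y /riso_inverse[F [G [hF hG FK GK]]]].
pose e (i : 'I_n) (y : N) : rpow N n := [ffun j => if j == i then y else 0].
have e_lin i : linear (e i).
  move=> k y z; apply/ffunP=> j; rewrite !ffunE.
  by case: eqP => // _; rewrite scaler0 addr0.
pose fi i (y : N) : regular B := (F (e i y)).1.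
have fi_lin i : linear (fi i).
  by move=> k y z; rewrite /fi e_lin linearP.
pose f i : 'Hom(N, regular B) := lfun_of (fi_lin i).
pose x : rpow N n := G (1, 0).
exists n, (fun i => x i), f; split.
  move=> i y b; rewrite !lfun_ofE /fi.
  have -> : e i (ract y b) = ract (e i y) b.
    apply/ffunP=> j; rewrite !ffunE; case: eqP => // _.
    by rewrite ract0.
  by rewrite hF.
under eq_bigr do rewrite lfun_ofE.
have E : x = \sum_i e i (x i).
  apply/ffunP=> j; rewrite sum_ffunE (bigD1 j) //= ffunE eqxx big1 ?addr0 //.
  by move=> i ij; rewrite ffunE eq_sym (negPf ij).
transitivity (F x).1; last by rewrite /x GK.
rewrite {2}E linear_sum /=.
by elim/big_rec2: _ => // i u v _ ->.
Qed.

Lemma gendo_symmetric_trace_data (K : fieldType) (A : falgType K) :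
  gendo_symmetric A -> inhabited (trace_data A).
Proof.
case=> B [N [[psi [psi_bij psi_act]] genN [phi [phi1 phiM phi_inj phi_im]]]].
have [t tE] := dual_lift psi_bij psi_act N.
pose tm := tM psi_bij psi_act tE.
have [n [x [f [hf sumf]]]] := generator_unit genN.
have phi_rhom c : is_rhom (phi c) by apply/phi_im; exists c.
have t_lin mu : linear (t mu) := t_linearr psi_bij psi_act tE mu.
have t_linl y : linear (t^~ y) := t_linearl psi_bij psi_act tE y.
have q_lin (y : N) (mu : 'Hom(N, K^o)) : linear (fun z => ract y (t mu z)).
  by move=> k z w; rewrite t_lin ract_linearr.
pose q y mu : 'End(N) := lfun_of (q_lin y mu).
have qE y mu z : q y mu z = ract y (t mu z) by rewrite lfun_ofE.
have H (u : N * 'Hom(N, K^o)) : exists a, q u.1 u.2 = phi a.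
  by apply/phi_im => z b; rewrite !qE tm ractM.
have [tr' tr'E] := choice H.
pose tr y mu := tr' (y, mu).
have trE y mu z : phi (tr y mu) z = ract y (t mu z) by rewrite -tr'E qE.
have trP a y mu : (forall z, phi a z = ract y (t mu z)) -> tr y mu = a.
  by move=> E; apply: phi_inj; apply/lfunP=> z; rewrite trE E.
have form_t i y : t (psi 1 \o f i)%VF y = f i y.
  by apply: (psi_nondeg psi_bij psi_act) => b; rewrite tE comp_lfunE hf.
constructor.
apply: (@TraceData K A N phi tr n x (fun i => psi 1 \o f i)%VF) => //.
- move=> mu k y z; apply: trP => w.
  by rewrite linearP /= add_lfunE scale_lfunE !trE ract_linearl.
- move=> y k mu nu; apply: trP => w.
  by rewrite linearP /= add_lfunE scale_lfunE !trE t_linl ract_linearr.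
- by move=> c y mu; apply: trP => z; rewrite phiM comp_lfunE trE phi_rhom.
- move=> c y mu; apply: trP => z; rewrite phiM comp_lfunE trE; congr ract.
  by apply: (psi_nondeg psi_bij psi_act) => b; rewrite !tE comp_lfunE phi_rhom.
- move=> y nu z mu; rewrite !trE.
  have form1 (la : 'Hom(N, K^o)) w : la w = psi 1 (t la w).
    by rewrite -[t _ _]mulr1 tE ract1.
  by rewrite !form1 !tm (psi_sym psi_act).
- move=> y; under eq_bigr do rewrite trE form_t.
  by rewrite -ract_sumr sumf ract1.
- move=> g gE; apply/phi_im => y b.
  have -> : b = \sum_i (f i (ract (x i) b) : B).
    rewrite -[LHS]mul1r -sumf mulr_suml; apply: eq_bigr => i _.
    by rewrite hf.
  rewrite !ract_sumr linear_sum; apply: eq_bigr => i _.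
  by rewrite -form_t -[ract (g y) _]trE -gE trE.
Qed.

(** * Duality on projective-injective modules *)

Section TraceDuality.
Variables (K : fieldType) (A : falgType K) (T : trace_data A).
Local Notation N := (td_mod T).
Local Notation phi := (td_act T).
Local Notation tr := (@td_tr _ _ T).
Local Notation DN := 'Hom(N, K^o).
Implicit Types Q : rmodule A.

(** The dual of [td_unit], obtained from the symmetry. *)
Lemma dual_unit (nu : DN) :
  \sum_i (td_form i \o phi (tr (td_vec i) nu))%VF = nu.
Proof.
apply/lfunP=> y; rewrite sum_lfunE -{2}(td_unit y) linear_sum.
by apply: eq_bigr => i _; rewrite comp_lfunE td_sym.
Qed.

(** Hom_K (N, V) is the direct sum of dim V copies of the dual of N, and
    A embeds into Hom_K (N, N). Since the dual of N is Hom_B (N, B), these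
    modules contain all projective-injective ones as summands. *)
Section HomModule.
Variable V : vectType K.

Definition homN_act (h : 'Hom(N, V)) (a : A) : 'Hom(N, V) := (h \o phi a)%VF.

Fact homN_linearl a : linear (homN_act^~ a).
Proof. by move=> k g h; rewrite /homN_act comp_lfunDl comp_lfunZl. Qed.

Fact homN_linearr h : linear (homN_act h).
Proof.
by move=> k a b; rewrite /homN_act linearP comp_lfunDr comp_lfunZr.
Qed.

Fact homN_act1 h : homN_act h 1 = h.
Proof. by rewrite /homN_act td_act1 comp_lfun1r. Qed.

Fact homN_actM h a b : homN_act h (a * b) = homN_act (homN_act h a) b.
Proof. by rewrite /homN_act td_actM comp_lfunA. Qed.

Definition homN : rmodule A :=
  RModule homN_linearl homN_linearr homN_act1 homN_actM.

End HomModule.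

Lemma free_cover Q : exists n (g : 'Hom(rpow (regular A) n, Q)),
  is_rhom g /\ forall q, exists x, q = g x.
Proof.
pose e := vbasis {:Q}.
pose g (x : rpow (regular A) (\dim {:Q})) : Q :=
  \sum_(i < \dim {:Q}) ract e`_i (x i : A).
have g_lin : linear g.
  move=> k x y; rewrite /g scaler_sumr -big_split; apply: eq_bigr => i _.
  by rewrite !ffunE ract_linearr.
exists _, (lfun_of g_lin); split=> [x a | q].
  rewrite !lfun_ofE /g ract_suml; apply: eq_bigr => i _.
  by rewrite ffunE /= ractM.
exists [ffun i => (coord e i q)%:A : A]; rewrite lfun_ofE /g.
rewrite {1}(coord_vbasis (memvf q)); apply: eq_bigr => i _.
by rewrite ffunE -[X in ract _ X]addr0 ract_linearr ract1 ractr0 addr0.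
Qed.

Lemma projective_embedding Q : is_projective Q ->
  exists (V : vectType K) (iota : 'Hom(Q, homN V)),
    is_rhom iota /\ forall q, iota q = 0 -> q = 0.
Proof.
move=> projQ; have [n [g [hg sg]]] := free_cover Q.
have [s hs gs] := split_epi projQ hg sg.
pose V := ({ffun 'I_n -> N} : vectType K).
pose io (q : Q) (y : N) : V := [ffun i => phi (s q i) y].
have io_lin q : linear (io q).
  by move=> k y z; apply/ffunP=> i; rewrite !ffunE linearP.
have io_lin2 : linear (fun q => lfun_of (io_lin q) : homN V).
  move=> k q r; apply/lfunP=> y.
  rewrite add_lfunE scale_lfunE !lfun_ofE; apply/ffunP=> i.
  by rewrite !ffunE linearP !ffunE linearP add_lfunE scale_lfunE.
exists V, (lfun_of io_lin2); split=> [q a | q].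
  rewrite !lfun_ofE /=; apply/lfunP=> y; rewrite /homN_act comp_lfunE !lfun_ofE.
  by apply/ffunP=> i; rewrite !ffunE hs ffunE /= td_actM comp_lfunE.
rewrite lfun_ofE => E; rewrite -[q]gs.
suff -> : s q = 0 by rewrite linear0.
apply/ffunP=> i; rewrite [RHS]ffunE; apply: (@td_act_inj _ _ T).
apply/lfunP=> y; rewrite linear0 zero_lfunE.
have /ffunP/(_ i) := congr1 (fun h : 'Hom(N, V) => h y) E.
by rewrite lfun_ofE zero_lfunE !ffunE.
Qed.

Fact homN_map_linear (V W : vectType K) (c : 'Hom(V, W)) :
  linear (fun h : homN V => (c \o h)%VF : homN W).
Proof. by move=> k g h; rewrite comp_lfunDr -comp_lfunZr. Qed.

Definition homN_map (V W : vectType K) (c : 'Hom(V, W)) :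
  'Hom(homN V, homN W) := lfun_of (homN_map_linear c).

Lemma homN_mapE (V W : vectType K) (c : 'Hom(V, W)) h :
  homN_map c h = (c \o h)%VF.
Proof. exact: lfun_ofE. Qed.

Lemma rhom_homN_map (V W : vectType K) (c : 'Hom(V, W)) : is_rhom (homN_map c).
Proof. by move=> h a; rewrite !homN_mapE /= /homN_act comp_lfunA. Qed.

(** Projective-injective modules are direct summands of powers of Hom_K (N, K),
    given here by the coordinates of the inclusion and of the projection. *)
Lemma projinj_coordinates Q : is_projective Q -> is_injective Q ->
  exists m (u : 'I_m -> 'Hom(Q, homN K^o)) (v : 'I_m -> 'Hom(homN K^o, Q)),
  [/\ forall j, is_rhom (u j), forall j, is_rhom (v j)
    & forall q, \sum_j v j (u j q) = q].
Proof.
move=> projQ injQ; have [V [u [hu ui]]] := projective_embedding projQ.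
have [r hr ru] := split_mono injQ hu ui.
pose e := vbasis {:V}.
have inc_lin j : linear (fun k : K^o => (k : K) *: e`_j : V).
  by move=> k x y; rewrite scalerDl scalerA.
pose c j : 'Hom(V, K^o) := linfun (coord e j : {linear V -> K^o}).
exists _, (fun j => homN_map (c j) \o u)%VF,
  (fun j => r \o homN_map (lfun_of (inc_lin (nat_of_ord j))))%VF.
split=> [j | j | q]; try exact/rhom_comp/hu/rhom_homN_map.
  exact/(rhom_comp hr)/rhom_homN_map.
under eq_bigr do rewrite !comp_lfunE.
rewrite -[RHS]ru -linear_sum; congr (r _); apply/lfunP=> z.
rewrite sum_lfunE [RHS](coord_vbasis (memvf _)); apply: eq_bigr => j _.
by rewrite !homN_mapE !comp_lfunE lfun_ofE lfunE.
Qed.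

(** A projective-injective Q is spanned by its products with traces: this is
    true of the dual of N by [dual_unit], and passes to summands. *)
Lemma projinj_form_inj Q (xi : 'Hom(Q, K^o)) :
  is_projective Q -> is_injective Q ->
  (forall q y mu, xi (ract q (tr y mu)) = 0) -> forall q, xi q = 0.
Proof.
move=> projQ injQ xi0 q.
have [m [u [v [hu hv vu]]]] := projinj_coordinates projQ injQ.
rewrite -(vu q) linear_sum big1 // => j _ /=.
rewrite -[u j q]dual_unit linear_sum linear_sum big1 //= => i _.
by rewrite (hv j (td_form i)).
Qed.

(** For a module Q, a linear form xi on Q and a homomorphism f : Q -> A
    correspond to each other when xi (q tr(y, mu)) = mu (f(q) y). Every xi has a
    corresponding f, by density. If Q is projective-injective, it is enough to
    treat Q = Hom_K (N, K), where f is determined by its values on the forms of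
    [td_unit]; hence every f has a corresponding xi, which is unique by
    [projinj_form_inj]. This is the natural isomorphism D Q = Hom_A (Q, A). *)
Lemma projinj_form_of_hom Q (f : 'Hom(Q, regular A)) :
  is_projective Q -> is_injective Q -> is_rhom f ->
  exists xi : 'Hom(Q, K^o),
    forall q y mu, xi (ract q (tr y mu)) = mu (phi (f q) y).
Proof.
move=> projQ injQ hf.
have [m [u [v [hu hv vu]]]] := projinj_coordinates projQ injQ.
pose n j : N := \sum_i phi (f (v j (td_form i))) (td_vec i).
have tr_sum k (F : 'I_k -> N) mu : \sum_i tr (F i) mu = tr (\sum_i F i) mu.
  rewrite -(lfun_ofE (td_tr_linearl mu)) linear_sum /=.
  by apply: eq_bigr => i _; rewrite lfun_ofE.
have fE q : f q = \sum_j tr (n j) (u j q).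
  rewrite -[in LHS](vu q) linear_sum; apply: eq_bigr => j _ /=.
  rewrite -[in LHS](dual_unit (u j q)) 2!linear_sum /= -tr_sum.
  apply: eq_bigr => i _.
  by rewrite (hv j (td_form i)) hf /= td_trMl.
have xi_lin : linear (fun q => \sum_j (u j q : DN) (n j)).
  move=> k x y; rewrite scaler_sumr -big_split; apply: eq_bigr => j _ /=.
  by rewrite linearP add_lfunE scale_lfunE.
exists (lfun_of xi_lin) => q y mu; rewrite lfun_ofE fE linear_sum sum_lfunE.
rewrite linear_sum; apply: eq_bigr => j _ /=.
by rewrite hu /= /homN_act comp_lfunE -td_sym.
Qed.

Lemma bidual (Phi : DN -> K) : (forall k mu nu, Phi (k *: mu + nu) =
    k * Phi mu + Phi nu) -> exists z, forall mu : DN, mu z = Phi mu.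
Proof.
move=> Phi_lin; pose e := vbasis {:N}.
pose c j : DN := linfun (coord e j : {linear N -> K^o}).
exists (\sum_(j < \dim {:N}) Phi (c j) *: e`_j) => mu.
pose F : 'Hom(DN, K^o) := lfun_of (Phi_lin : linear (Phi : DN -> K^o)).
have -> : Phi mu = F mu by rewrite lfun_ofE.
have {2}-> : mu = \sum_(j < \dim {:N}) (mu e`_j : K) *: c j.
  apply/lfunP=> z; rewrite {1}(coord_vbasis (memvf z)) linear_sum sum_lfunE.
  apply: eq_bigr => j _; rewrite linearZ scale_lfunE lfunE.
  by rewrite [LHS]mulrC.
rewrite !linear_sum; apply: eq_bigr => j _.
by rewrite [LHS]linearZ [RHS]linearZ /= lfun_ofE [LHS]mulrC.
Qed.

(** mu (f(q) y) is prescribed for all mu, so that f(q) y is an element of the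
    bidual of N; the resulting map y |-> f(q) y commutes with the traces by
    symmetry. *)
Lemma hom_of_form Q (xi : 'Hom(Q, K^o)) :
  exists2 f : 'Hom(Q, regular A), is_rhom f &
    forall q y (mu : DN), mu (phi (f q) y) = xi (ract q (tr y mu)).
Proof.
have H (w : Q * N) : exists z, forall mu : DN, mu z = xi (ract w.1 (tr w.2 mu)).
  apply: bidual => k mu nu.
  by rewrite td_tr_linearr ract_linearr linearP.
have [z zE] := choice H.
have eqN (x y : N) : (forall mu : DN, mu x = mu y) -> x = y.
  move=> E; apply/eqP; rewrite -subr_eq0; apply/eqP/lfun_sep => mu.
  by rewrite linearB /= E subrr.
have z_lin q : linear (fun y => z (q, y)).
  move=> k x y; apply: eqN => mu.
  by rewrite [RHS]linearP !zE /= td_tr_linearl ract_linearr [LHS]linearP /= !zE.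
have F q : exists a, lfun_of (z_lin q) = phi a.
  apply: td_dense => y nu w; apply: eqN => mu.
  rewrite !lfun_ofE zE /= td_sym -comp_lfunE zE /=.
  by rewrite td_trMl td_trMr.
have [f fE] := choice F.
have fP q y (mu : DN) : mu (phi (f q) y) = xi (ract q (tr y mu)).
  by rewrite -fE lfun_ofE zE.
have eqA a b : (forall y (mu : DN), mu (phi a y) = mu (phi b y)) -> a = b.
  move=> E; apply: (@td_act_inj _ _ T); apply/lfunP=> y.
  by apply: eqN => mu; apply: E.
have f_lin : linear (f : Q -> regular A).
  move=> k x y; apply: eqA => w mu.
  rewrite fP ract_linearl [LHS]linearP [phi _]linearP add_lfunE scale_lfunE.
  by rewrite [RHS]linearP /= !fP.
exists (lfun_of f_lin) => [q a | q y mu]; rewrite !lfun_ofE //.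
apply: eqA => y mu; rewrite fP /= td_actM comp_lfunE fP.
by rewrite td_trMl ractM.
Qed.

(** On projective-injective modules Hom_A (-, A) is isomorphic to the duality
    D, hence preserves exactness. The last term Q3 is arbitrary because a form
    on it always yields a homomorphism. *)
Lemma hom_regular_exact Q1 Q2 Q3 (d1 : 'Hom(Q1, Q2)) (d2 : 'Hom(Q2, Q3))
    (f : 'Hom(Q2, regular A)) :
  is_projective Q1 -> is_injective Q1 -> is_projective Q2 -> is_injective Q2 ->
  is_rhom d1 -> is_rhom d2 -> is_rhom f ->
  (forall y, d2 y = 0 -> exists x, y = d1 x) -> (forall x, f (d1 x) = 0) ->
  exists2 f' : 'Hom(Q3, regular A), is_rhom f' & forall x, f x = f' (d2 x).
Proof.
move=> projQ1 injQ1 projQ2 injQ2 hd1 hd2 hf ex fd1.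
(* f corresponds to a form xi vanishing on the image of d1, hence on the kernel
   of d2; then xi extends along d2, and f' corresponds to the extension *)
have [xi xiE] := projinj_form_of_hom projQ2 injQ2 hf.
have xid1 x : (xi \o d1)%VF x = 0.
  apply: projinj_form_inj => // q y mu.
  by rewrite comp_lfunE hd1 xiE fd1 linear0 zero_lfunE linear0.
have [f' hf' f'E] := hom_of_form (xi \o d2^-1)%VF.
exists f' => // q; apply: (@td_act_inj _ _ T); apply/lfunP=> y.
apply/eqP; rewrite -subr_eq0; apply/eqP/lfun_sep => mu.
rewrite linearB /= f'E -xiE comp_lfunE -linearB -hd2.
set w := ract q _.
have [|x ->] := ex (w - (d2^-1)%VF (d2 w)); last by have := xid1 x; rewrite comp_lfunE.
rewrite linearB /= limg_lfunVK ?subrr //; exact: memv_img (memvf _).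
Qed.

End TraceDuality.

(** * Indecomposable summands *)

Section Indecomposables.
Variables (K : fieldType) (A : falgType K).
Implicit Types M N P S X Y Z : rmodule A.

Section DirectSum.
Variables X Y : rmodule A.

Fact inl_linear : linear (fun x : X => (x, 0) : rsum X Y).
Proof. by move=> k x y; congr pair; rewrite /= ?scaler0 ?addr0. Qed.

Fact inr_linear : linear (fun y : Y => (0, y) : rsum X Y).
Proof. by move=> k x y; congr pair; rewrite /= ?scaler0 ?addr0. Qed.

Fact fst_linear : linear (fun z : rsum X Y => z.1 : X).
Proof. by []. Qed.

Fact snd_linear : linear (fun z : rsum X Y => z.2 : Y).
Proof. by []. Qed.

Definition rsum_inl : 'Hom(X, rsum X Y) := lfun_of inl_linear.
Definition rsum_inr : 'Hom(Y, rsum X Y) := lfun_of inr_linear.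
Definition rsum_fst : 'Hom(rsum X Y, X) := lfun_of fst_linear.
Definition rsum_snd : 'Hom(rsum X Y, Y) := lfun_of snd_linear.

Lemma rhom_rsum_inl : is_rhom rsum_inl.
Proof. by move=> x a; rewrite !lfun_ofE /= /rsum_act /= ract0. Qed.

Lemma rhom_rsum_inr : is_rhom rsum_inr.
Proof. by move=> x a; rewrite !lfun_ofE /= /rsum_act /= ract0. Qed.

Lemma rhom_rsum_fst : is_rhom rsum_fst.
Proof. by move=> x a; rewrite !lfun_ofE. Qed.

Lemma rhom_rsum_snd : is_rhom rsum_snd.
Proof. by move=> x a; rewrite !lfun_ofE. Qed.

Lemma rsumE (z : rsum X Y) : z = rsum_inl (rsum_fst z) + rsum_inr (rsum_snd z).
Proof.
case: z => x y; rewrite !lfun_ofE; congr pair => /=.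
  by rewrite addr0.
by rewrite add0r.
Qed.

Lemma retract_rsum_inl : is_retract X (rsum X Y).
Proof.
exists rsum_inl, rsum_fst; split; last by move=> x; rewrite !lfun_ofE.
  exact: rhom_rsum_inl.
exact: rhom_rsum_fst.
Qed.

Lemma retract_rsum_inr : is_retract Y (rsum X Y).
Proof.
exists rsum_inr, rsum_snd; split; last by move=> x; rewrite !lfun_ofE.
  exact: rhom_rsum_inr.
exact: rhom_rsum_snd.
Qed.

Lemma rsum_projective :
  is_projective X -> is_projective Y -> is_projective (rsum X Y).
Proof.
move=> projX projY V W g f hg hf sg.
have [h hh E] := projX _ _ g (f \o rsum_inl)%VF hg (rhom_comp hf rhom_rsum_inl) sg.
have [h' hh' E'] := projY _ _ g (f \o rsum_inr)%VF hg (rhom_comp hf rhom_rsum_inr) sg.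
exists ((h \o rsum_fst) + (h' \o rsum_snd))%VF.
  by apply: rhomD; apply: rhom_comp => //; [exact: rhom_rsum_fst | exact: rhom_rsum_snd].
apply/lfunP=> z; rewrite {1}(rsumE z) linearD /= -!(comp_lfunE f) E E'.
by rewrite !comp_lfunE add_lfunE !comp_lfunE linearD.
Qed.

Lemma internal_sum M (i : 'Hom(X, M)) (j : 'Hom(Y, M)) :
  is_rhom i -> is_rhom j -> (forall x y, i x + j y = 0 -> x = 0 /\ y = 0) ->
  (forall m, exists x y, m = i x + j y) -> riso M (rsum X Y).
Proof.
move=> hi hj inj surj; apply: riso_sym.
pose f := ((i \o rsum_fst) + (j \o rsum_snd))%VF.
have fE z : f z = i z.1 + j z.2 by rewrite add_lfunE !comp_lfunE !lfun_ofE.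
apply: (@bij_riso _ _ _ _ f).
- by apply: rhomD; apply: rhom_comp => //; [exact: rhom_rsum_fst | exact: rhom_rsum_snd].
- by move=> [x y]; rewrite fE => /inj[/= -> ->].
- by move=> m; have [x [y ->]] := surj m; exists (x, y); rewrite fE.
Qed.

End DirectSum.

Lemma summand_retract X M : is_summand X M -> is_retract X M.
Proof.
case=> Y /riso_sym/riso_retract; apply: retract_trans.
exact: retract_rsum_inl.
Qed.

Lemma retract_summand X M : is_retract X M -> is_summand X M.
Proof.
case=> u [v [hu hv vu]]; pose hU := is_submod_lker hv; exists (submod hU).
have hi := @rhom_submod_incl _ _ _ _ hU.
have vi y : v (submod_incl hU y) = 0.
  by apply/eqP; rewrite -memv_ker submod_incl_mem.
apply: (internal_sum hu hi) => [x y E | m].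
  have x0 : x = 0.
    by have := congr1 v E; rewrite linearD /= vu vi addr0 linear0.
  split=> //; apply: (@submod_incl_inj _ _ _ _ hU).
  by move: E; rewrite x0 linear0 add0r.
have /(submod_inclP hU)[y yE] : m - u (v m) \in lker v.
  by rewrite memv_ker linearB /= vu subrr.
by exists (v m), y; rewrite -yE addrC subrK.
Qed.

Lemma dim_lt_of_mono X M (u : 'Hom(X, M)) : (forall x, u x = 0 -> x = 0) ->
  (exists m, forall x, m <> u x) -> (\dim {:X} < \dim {:M})%N.
Proof.
move=> inj [m nm]; have /eqP kE : lker u == 0%VS by apply/eqP/lker_zeroP.
rewrite -(limg_dim_eq (f := u)) ?kE ?capv0 //.
rewrite ltn_neqAle dimvS ?subvf // andbT; apply/eqP=> E.
have Eim : limg u = fullv by apply/eqP; rewrite eqEdim subvf E /=.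
have [x Ex] := (limg_fullP u).1 Eim m.
exact: (nm x).
Qed.

Lemma rsum_dim_ltl X Y M : riso M (rsum X Y) -> rnonzero Y ->
  (\dim {:X} < \dim {:M})%N.
Proof.
move=> /riso_inverse[f [g [hf hg fK gK]]] [y /eqP y0].
apply: (@dim_lt_of_mono _ _ (g \o rsum_inl X Y)%VF) => [x | ].
  rewrite comp_lfunE => /(congr1 f); rewrite gK linear0 lfun_ofE.
  by case.
exists (g (0, y)) => x; rewrite comp_lfunE => /(congr1 f); rewrite !gK lfun_ofE.
by case.
Qed.

Lemma rsum_dim_ltr X Y M : riso M (rsum X Y) -> rnonzero X ->
  (\dim {:Y} < \dim {:M})%N.
Proof.
move=> /riso_inverse[f [g [hf hg fK gK]]] [x /eqP x0].
apply: (@dim_lt_of_mono _ _ (g \o rsum_inr X Y)%VF) => [y | ].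
  rewrite comp_lfunE => /(congr1 f); rewrite gK linear0 lfun_ofE.
  by case.
exists (g (x, 0)) => y; rewrite comp_lfunE => /(congr1 f); rewrite !gK lfun_ofE.
by case.
Qed.

(** Existence of a decomposition into indecomposables, as an induction
    principle. *)
Lemma indecomposable_ind (Q : rmodule A -> Prop) :
  (forall X, ~ rnonzero X -> Q X) ->
  (forall M X Y, riso M (rsum X Y) -> Q X -> Q Y -> Q M) ->
  forall M, (forall X, is_indecomposable X -> is_retract X M -> Q X) -> Q M.
Proof.
move=> Q0 QD M; have [n] := ubnP (\dim {:M}); elim: n M => // n IHn M.
rewrite ltnS => leM QM; have [nzM | /Q0//] := pselect (rnonzero M).
have [iM | niM] := pselect (is_indecomposable M).
  exact/QM/riso_retract/riso_refl.
have [X [Y [iso nzX nzY]]] : exists X Y,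
    [/\ riso M (rsum X Y), rnonzero X & rnonzero Y].
  apply: contrapT => H; apply: niM; split=> // X Y iso.
  have [nzX | ] := pselect (rnonzero X); last by left.
  by right=> nzY; apply: H; exists X, Y.
have Mr : is_retract (rsum X Y) M by apply/riso_retract/riso_sym.
apply: (QD _ _ _ iso); apply: IHn.
- exact: leq_trans (rsum_dim_ltl iso nzY) leM.
- move=> Z iZ ZX; apply: QM => //; apply: retract_trans Mr.
  exact: retract_trans (retract_rsum_inl X Y).
- exact: leq_trans (rsum_dim_ltr iso nzX) leM.
- move=> Z iZ ZX; apply: QM => //; apply: retract_trans Mr.
  exact: retract_trans (retract_rsum_inr X Y).
Qed.

Lemma zero_projective X : ~ rnonzero X -> is_projective X.
Proof.
move=> X0; have {}X0 (x : X) : x = 0.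
  by have [// | nx] := eqVneq x 0; case: X0; exists x.
move=> V W g f hg hf sg; exists 0; first exact: rhom0.
by apply/lfunP=> x; rewrite (X0 x) !linear0.
Qed.

Lemma nonprojective_indecomposable M : ~ is_projective M ->
  exists X, [/\ is_indecomposable X, is_retract X M & ~ is_projective X].
Proof.
move=> nM; apply: contrapT => H; apply: nM.
apply: (indecomposable_ind (Q := @is_projective _ _)).
- exact: zero_projective.
- move=> Z X Y iso pX pY.
  exact: retract_projective (riso_retract iso) (rsum_projective pX pY).
- by move=> X iX rX; apply: contrapT => nX; apply: H; exists X.
Qed.

Lemma indecomposable_to_nonzero_hom M S (f : 'Hom(M, S)) :
  is_rhom f -> (exists x, f x != 0) ->
  exists X (g : 'Hom(X, S)),
    [/\ is_indecomposable X, is_retract X M, is_rhom g & exists x, g x != 0].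
Proof.
move=> hf [x0 fx0]; apply: contrapT => H.
suff : forall g : 'Hom(M, S), is_rhom g -> forall x, g x = 0.
  by move/(_ f hf x0)/eqP; apply/negP.
apply: (indecomposable_ind
   (Q := fun X => forall g : 'Hom(X, S), is_rhom g -> forall x, g x = 0)).
- move=> X X0 g _ x; have [-> | nx] := eqVneq x 0; first exact: linear0.
  by case: X0; exists x.
- move=> Z X Y /riso_inverse[u [v [hu hv uv vu]]] gX gY g hg z.
  have hgv := rhom_comp hg hv.
  rewrite -[z]uv (rsumE (u z)) -comp_lfunE linearD /= -!(comp_lfunE (g \o v)%VF).
  rewrite gX ?gY ?addr0 //; apply: rhom_comp => //.
    exact: rhom_rsum_inr.
  exact: rhom_rsum_inl.
- move=> X iX rX g hg x; have [// | gx] := eqVneq (g x) 0.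
  by case: H; exists X, g; split=> //; exists x.
Qed.

(** Fitting's lemma: if g is a power of h with image of least dimension, then
    P is the direct sum of the kernel and of the image of g. *)
Lemma fitting P (h : 'Hom(P, P)) : is_indecomposable P -> is_rhom h ->
  (exists n, forall x, iter n h x = 0) \/ (forall y, exists x, y = h x).
Proof.
move=> [_ iP] hh; pose H n : 'Hom(P, P) := iter n (fun g => (h \o g)%VF) \1%VF.
have HE n x : H n x = iter n h x.
  elim: n x => [|n IHn] x /=; first by rewrite id_lfunE.
  by rewrite comp_lfunE IHn.
have hH n : is_rhom (H n).
  by elim: n => [|n IHn]; [exact: rhom_id | exact: rhom_comp].
have [n [_ n_min]] : exists n, True /\
    forall m, (\dim (limg (H n)) <= \dim (limg (H m)))%N.
  have exP : exists d, `[< exists n, \dim (limg (H n)) = d >].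
    by exists (\dim (limg (H 0%N))); apply/asboolP; exists 0%N.
  case: (ex_minnP exP) => d /asboolP[n nd] d_min; exists n; split=> // m.
  by rewrite nd; apply: d_min; apply/asboolP; exists m.
pose g := H n.+1.
have Hadd m k x : H (m + k)%N x = H m (H k x) by rewrite !HE iterD.
have sub_im m k : (limg (H (m + k)%N) <= limg (H m))%VS.
  apply/subvP=> _ /memv_imgP[x _ ->]; rewrite Hadd.
  exact: memv_img (memvf _).
have dim_im m : \dim (limg (H (n + m)%N)) = \dim (limg (H n)).
  by apply/eqP; rewrite eqn_leq n_min dimvS // sub_im.
have im_gg y : exists x, g y = g (g x).
  have /memv_imgP[x _ E] : g y \in limg (H (n.+1 + n.+1)%N).
    have -> : limg (H (n.+1 + n.+1)%N) = limg g.
      apply/eqP; rewrite eqEdim sub_im andTb /g addSnnS.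
      by rewrite -[in X in (X <= _)%N]addn1 !dim_im.
    exact: memv_img (memvf _).
  by exists x; rewrite E Hadd.
have ker_im y : g (g y) = 0 -> g y = 0.
  move=> ggy; have := limg_ker_dim g (limg g).
  have -> : (g @: limg g)%VS = limg g.
    apply/eqP; rewrite eqEsubv; apply/andP; split; apply/subvP => z.
      by case/memv_imgP=> w _ ->; exact: memv_img (memvf _).
    case/memv_imgP=> w _ ->; have [x ->] := im_gg w.
    exact/memv_img/memv_img/memvf.
  move/eqP; rewrite -{2}[\dim (limg g)]add0n eqn_add2r dimv_eq0 => /eqP E.
  apply/eqP; rewrite -memv0 -E memv_cap memv_ker ggy eqxx andbT.
  exact: memv_img (memvf _).
pose hK := is_submod_lker (hH n.+1); pose hL := is_submod_limg (hH n.+1).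
have iso : riso P (rsum (submod hK) (submod hL)).
  have hiK := @rhom_submod_incl _ _ _ _ hK.
  have hiL := @rhom_submod_incl _ _ _ _ hL.
  have gK x : g (submod_incl hK x) = 0.
    by apply/eqP; rewrite -memv_ker submod_incl_mem.
  have imL y : exists z, submod_incl hL y = g z.
    by have /memv_imgP[z _ ->] := submod_incl_mem y; exists z.
  apply: (internal_sum hiK hiL) => [x y E | m].
    have [z zE] := imL y.
    have y0 : submod_incl hL y = 0.
      rewrite zE; apply: ker_im; rewrite -zE.
      by have := congr1 g E; rewrite linearD /= gK add0r linear0.
    split; last exact: submod_incl_inj y0.
    by apply: (@submod_incl_inj _ _ _ _ hK); move: E; rewrite y0 addr0.
  have [z zE] := im_gg m.
  have /(submod_inclP hK)[x xE] : m - g z \in lker g.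
    by rewrite memv_ker linearB /= zE subrr.
  have /(submod_inclP hL)[y yE] : g z \in limg g by exact: memv_img (memvf _).
  by exists x, y; rewrite -xE -yE subrK.
case: (iP _ _ iso) => [K0 | L0].
  right=> y.
  have surj_g : limg g = fullv.
    have k0 : lker g == 0%VS.
      apply/eqP/lker_zeroP => x gx.
      have /(submod_inclP hK)[z zE] : x \in lker g by rewrite memv_ker gx.
      have [z0 | nz] := eqVneq z 0; first by rewrite zE z0 linear0.
      by case: K0; exists z.
    apply/eqP; rewrite eqEdim subvf /= limg_dim_eq //.
    by rewrite (eqP k0) capv0.
  have [x ->] := (limg_fullP g).1 surj_g y.
  by exists (H n x); rewrite /g /= comp_lfunE.
left; exists n.+1 => x; rewrite -HE.
have /(submod_inclP hL)[z ->] : g x \in limg g by exact: memv_img (memvf _).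
have [-> | nz] := eqVneq z 0; first exact: linear0.
by case: L0; exists z.
Qed.

(** * Simple modules and projective covers *)

Lemma simple_surj X S (f : 'Hom(X, S)) :
  is_simple S -> is_rhom f -> (exists x, f x != 0) -> forall y, exists x, y = f x.
Proof.
move=> [_ sS] hf [x fx]; apply/limg_fullP.
have [E | //] := sS _ (is_submod_limg hf).
have : f x \in limg f by exact: memv_img (memvf _).
by rewrite E memv0 (negPf fx).
Qed.

Lemma schur_factor X S S' (f : 'Hom(X, S)) (f' : 'Hom(X, S')) :
  is_simple S -> is_simple S' -> is_rhom f -> is_rhom f' ->
  (exists x, f x != 0) -> (exists x, f' x != 0) ->
  (forall x, f x = 0 -> f' x = 0) -> riso S S'.
Proof.
move=> sS sS' hf hf' nf nf' ker.
have sf := simple_surj sS hf nf; have sf' := simple_surj sS' hf' nf'.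
have [g hg gE] := factor_epi hf hf' sf ker.
apply: (bij_riso hg) => [y gy | y].
  have [E | E] := sS.2 _ (is_submod_lker hg).
    by apply/eqP; rewrite -memv0 -E memv_ker gy.
  have [x /eqP[]] := nf'; rewrite gE; apply/eqP; rewrite -memv_ker E.
  exact: memvf.
by have [x ->] := sf' y; exists (f x).
Qed.

(** An indecomposable projective has a single simple quotient: for two of
    them the projection of P onto the first one lifts to an endomorphism of
    P which is neither nilpotent nor surjective. *)
Lemma indecomposable_projective_top P S S' (f : 'Hom(P, S)) (f' : 'Hom(P, S')) :
  is_indecomposable P -> is_projective P ->
  is_simple S -> is_simple S' -> is_rhom f -> is_rhom f' ->
  (exists x, f x != 0) -> (exists x, f' x != 0) -> riso S S'.
Proof.
move=> iP pP sS sS' hf hf' nf nf'.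
have [ker | nker] := pselect (forall x, f x = 0 -> f' x = 0).
  exact: schur_factor ker.
have sf := simple_surj sS hf nf.
have hK := is_submod_lker hf.
have sK y : exists x, f x = 0 /\ y = f' x.
  have [||x ->] := @simple_surj _ _ (f' \o submod_incl hK)%VF sS' _ _ y.
  - exact/(rhom_comp hf')/rhom_submod_incl.
  - apply: contrapT => H; apply: nker => x fx; have [// | nx] := eqVneq (f' x) 0.
    have /(submod_inclP hK)[z zE] : x \in lker f by rewrite memv_ker fx.
    by case: H; exists z; rewrite comp_lfunE -zE.
  exists (submod_incl hK x); rewrite comp_lfunE; split=> //.
  by apply/eqP; rewrite -memv_ker submod_incl_mem.
pose g := ((rsum_inl S S' \o f) + (rsum_inr S S' \o f'))%VF.
have gE x : g x = (f x, f' x).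
  rewrite add_lfunE !comp_lfunE !lfun_ofE.
  by congr pair; rewrite /= ?addr0 ?add0r.
have hg : is_rhom g by move=> x a; rewrite !gE hf hf'.
have [x|h hh hE] := projective_lift pP hg (rhom_comp (@rhom_rsum_inl S S') hf).
  rewrite comp_lfunE lfun_ofE; have [y [fy yE]] := sK (- f' x).
  exists (x + y); rewrite gE !linearD /= fy -yE subrr addr0 //.
have {}hE x : f (h x) = f x /\ f' (h x) = 0.
  by have := hE x; rewrite gE comp_lfunE lfun_ofE => -[-> ->].
case: (fitting iP hh) => [[n nil] | surj].
  have [x /eqP[]] := nf; rewrite -[RHS](linear0 f) -(nil x).
  by elim: n {nil} => // n IHn; rewrite /= (hE _).1.
by have [x /eqP[]] := nf'; have [y ->] := surj x; exact: (hE y).2.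
Qed.

Lemma simple_orbit S : is_simple S ->
  exists f : 'Hom(regular A, S), is_rhom f /\ exists x, f x != 0.
Proof.
case=> [[x nx] _]; exists (orbit_map x); split; first exact: rhom_orbit_map.
by exists (1 : A); rewrite orbit_mapE ract1.
Qed.

(** The kernel of the last homomorphism is a proper submodule on which the
    others stay nonzero, for otherwise two of the simples would be
    isomorphic. *)
Lemma simple_count_le X n (S : 'I_n -> rmodule A)
    (f : forall i, 'Hom(X, S i)) :
  (forall i, is_simple (S i)) -> (forall i j, riso (S i) (S j) -> i = j) ->
  (forall i, is_rhom (f i)) -> (forall i, exists x, f i x != 0) ->
  (n <= \dim {:X})%N.
Proof.
elim: n X S f => // n IHn X S f sS iS hf nf.
have hK := is_submod_lker (hf ord_max).
have lift_max (i : 'I_n) : lift ord_max i != ord_max by rewrite eq_sym neq_lift.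
apply: (@leq_ltn_trans (\dim {:submod hK})).
  apply: (IHn _ (fun i => S (lift ord_max i))
    (fun i => f (lift ord_max i) \o submod_incl hK)%VF) => //.
  - by move=> i j /iS/lift_inj.
  - by move=> i; apply/(rhom_comp (hf _))/rhom_submod_incl.
  move=> i; apply: contrapT => H.
  have/eqP[] := lift_max i; apply/esym/iS.
  apply: schur_factor (hf _) (hf _) (nf _) (nf _) _ => // x fx.
  have [// | nx] := eqVneq (f (lift ord_max i) x) 0; case: H.
  have /(submod_inclP hK)[z zE] : x \in lker (f ord_max) by rewrite memv_ker fx.
  by exists z; rewrite comp_lfunE -zE.
apply: dim_lt_of_mono; first exact: (@submod_incl_inj _ _ _ _ hK).
have [x /negP nx] := nf ord_max; exists x => y E; apply: nx.
by rewrite -memv_ker E submod_incl_mem.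
Qed.

Lemma simple_projective_covers n (S : 'I_n -> rmodule A) :
  (forall i, is_simple (S i)) -> (forall i j, riso (S i) (S j) -> i = j) ->
  exists P : 'I_n -> rmodule A,
  [/\ forall i, is_indecomposable (P i), forall i, is_projective (P i),
      forall i, is_retract (P i) (regular A)
    & forall i j, riso (P i) (P j) -> i = j].
Proof.
move=> sS iS.
have H i : exists P, [/\ is_indecomposable P, is_retract P (regular A) &
    exists f : 'Hom(P, S i), is_rhom f /\ exists x, f x != 0].
  have [f [hf nf]] := simple_orbit (sS i).
  have [P [g [iP rP hg ng]]] := indecomposable_to_nonzero_hom hf nf.
  by exists P; split=> //; exists g.
have [P hP] := choice H; exists P.
have pP i : is_projective (P i).
  have [_ rP _] := hP i.
  exact/(retract_projective rP)/regular_projective.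
split=> [i|//|i|i j iso]; try by case: (hP i).
have [iPi _ [f [hf nf]]] := hP i; have [_ _ [g [hg [y ny]]]] := hP j.
have [u [v [hu _ _ vu]]] := riso_inverse iso; apply: iS.
apply: (indecomposable_projective_top iPi (pP i) (sS i) (sS j) hf
  (rhom_comp hg hu) nf).
by exists (v y); rewrite comp_lfunE vu.
Qed.

End Indecomposables.

(** * Additive closures *)

Section AdditiveClosure.
Variables (K : fieldType) (A : falgType K).
Implicit Types M N P X Y Z : rmodule A.

(** A class with these closure properties that contains M contains add (M). *)
Definition additive_class (Q : rmodule A -> Prop) :=
  (forall X Y, is_retract X Y -> Q Y -> Q X) /\
  (forall X Y, Q X -> Q Y -> Q (rsum X Y)).

Lemma rpow_class (Q : rmodule A -> Prop) M n :
  additive_class Q -> Q M -> Q (rpow M n.+1).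
Proof.
case=> Qr Qs QM; elim: n => [|n IHn].
  have lin : linear (fun x : rpow M 1 => x ord0 : M).
    by move=> k x y; rewrite !ffunE.
  apply: (Qr _ M) => //; apply: riso_retract; apply: (@bij_riso _ _ _ _ (lfun_of lin)).
  - by move=> x a; rewrite !lfun_ofE ffunE.
  - move=> x; rewrite lfun_ofE => x0; apply/ffunP=> i.
    by rewrite ord1 x0 ffunE.
  - by move=> y; exists [ffun=> y]; rewrite lfun_ofE ffunE.
have lin : linear (fun x : rpow M n.+2 =>
    (x ord0, [ffun i => x (lift ord0 i)]) : rsum M (rpow M n.+1)).
  move=> k x y; congr pair; first by rewrite !ffunE.
  by apply/ffunP=> i; rewrite !ffunE.
apply: (Qr _ (rsum M (rpow M n.+1))); last exact: Qs.
apply: riso_retract; apply: (@bij_riso _ _ _ _ (lfun_of lin)).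
- move=> x a; rewrite !lfun_ofE; congr pair; first by rewrite ffunE.
  by apply/ffunP=> i; rewrite !ffunE.
- move=> x; rewrite lfun_ofE => -[x0 /ffunP xl]; apply/ffunP=> i.
  rewrite ffunE; case: (unliftP ord0 i) => [j|] -> //.
  by have := xl j; rewrite !ffunE.
- move=> [y z]; exists [ffun i => if unlift ord0 i is Some j then z j else y].
  rewrite lfun_ofE; congr pair; first by rewrite ffunE unlift_none.
  by apply/ffunP=> i; rewrite !ffunE liftK.
Qed.

Lemma in_add_class (Q : rmodule A -> Prop) M X :
  additive_class Q -> Q M -> in_add M X -> Q X.
Proof.
move=> cQ QM [[//|n] _ /summand_retract]; move: (cQ) => [Qr _] r.
by apply: (Qr _ _ r); apply: rpow_class.
Qed.

Fixpoint msum (F : nat -> rmodule A) (r : nat) : rmodule A :=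
  if r is s.+1 then rsum (msum F s) (F r) else F 0%N.

Lemma msum_class (Q : rmodule A -> Prop) F r : additive_class Q ->
  (forall j, (j <= r)%N -> Q (F j)) -> Q (msum F r).
Proof.
move=> [Qr Qs]; elim: r => [|r IHr] QF; first exact: QF.
by apply: Qs; [apply: IHr => j /leqW; exact: QF | exact: QF].
Qed.

Lemma retract_msum F r j : (j <= r)%N -> is_retract (F j) (msum F r).
Proof.
elim: r => [|r IHr]; first by rewrite leqn0 => /eqP ->; exact/riso_retract/riso_refl.
rewrite leq_eqVlt => /orP[/eqP -> | /IHr H]; first exact: retract_rsum_inr.
exact: retract_trans H (retract_rsum_inl _ _).
Qed.

Lemma hom_exact_class (J : nat -> rmodule A) (D : forall s, 'Hom(J s, J s.+1)) n :
  additive_class (fun X => hom_exact D X n).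
Proof.
split=> [X Y [u [v [hu hv vu]]] E g hg Dg | X Y E E' g hg Dg].
  have [x|g' hg' g'E] := E (g \o v)%VF (rhom_comp hg hv).
    by rewrite comp_lfunE.
  exists (g' \o u)%VF; first exact: rhom_comp.
  by move=> x; rewrite comp_lfunE -g'E comp_lfunE vu.
have [x|h hh hE] := E _ (rhom_comp hg (@rhom_rsum_inl _ _ X Y)).
  by rewrite comp_lfunE.
have [x|h' hh' h'E] := E' _ (rhom_comp hg (@rhom_rsum_inr _ _ X Y)).
  by rewrite comp_lfunE.
exists ((h \o rsum_fst X Y) + (h' \o rsum_snd X Y))%VF.
  by apply: rhomD; apply: rhom_comp => //; [exact: rhom_rsum_fst | exact: rhom_rsum_snd].
move=> z; rewrite {1}(rsumE z) add_lfunE !comp_lfunE !linearD /=.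
by rewrite -hE -h'E !comp_lfunE.
Qed.

Lemma projective_class : additive_class (@is_projective K A).
Proof. by split; [exact: retract_projective | exact: rsum_projective]. Qed.

Lemma ext_vanishes_class j X : additive_class (ext_vanishes j.+1 X).
Proof.
split=> [Y Y' [u [v [hu hv vu]]] E P f | Y Y' E E' P f] [hf /comp_lfun0 fd].
  have [|g hg gE] := E P (u \o f)%VF.
    split; first exact: rhom_comp.
    by apply/lfunP=> x; rewrite !comp_lfunE fd linear0 zero_lfunE.
  exists (v \o g)%VF; first exact: rhom_comp.
  by apply/lfunP=> x; rewrite -comp_lfunA -gE !comp_lfunE vu.
have [|g hg gE] := E P (rsum_fst Y Y' \o f)%VF.
  split; first exact/(rhom_comp _ hf)/rhom_rsum_fst.
  by apply/lfunP=> x; rewrite !comp_lfunE fd linear0 zero_lfunE.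
have [|g' hg' g'E] := E' P (rsum_snd Y Y' \o f)%VF.
  split; first exact/(rhom_comp _ hf)/rhom_rsum_snd.
  by apply/lfunP=> x; rewrite !comp_lfunE fd linear0 zero_lfunE.
exists ((rsum_inl Y Y' \o g) + (rsum_inr Y Y' \o g'))%VF.
  by apply: rhomD; apply: rhom_comp => //; [exact: rhom_rsum_inl | exact: rhom_rsum_inr].
apply/lfunP=> x; rewrite comp_lfunE add_lfunE !comp_lfunE.
by rewrite -!(comp_lfunE _ (pr_diff P j)) -gE -g'E !comp_lfunE -rsumE.
Qed.

(** A projective resolution of a projective module is contractible. *)
Lemma projective_ext_vanishes j X Y : is_projective X -> ext_vanishes j.+1 X Y.
Proof.
move=> projX P f [hf /comp_lfun0 fd].
have lift i (e : 'Hom(P i, P i)) : is_rhom e ->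
    (forall x, exists y, e x = pr_diff P i y) ->
    exists2 r : 'Hom(P i, P i.+1), is_rhom r & forall x, e x = pr_diff P i (r x).
  by move=> he; apply: projective_lift; [exact: pr_proj | exact: pr_diff_rhom |].
(* r splits the j-th differential off its image *)
have [r hr rE] : exists2 r : 'Hom(P j, P j.+1), is_rhom r &
    forall x, pr_diff P j (r (pr_diff P j x)) = pr_diff P j x.
  elim: j {f hf fd} => [|j [r hr rE]].
    have [d0 ex] := limg_lkerP (pr_exact0 P).
    have [s hs sE] := split_epi projX (@pr_aug_rhom _ _ _ P)
      ((limg_fullP _).1 (pr_aug_surj P)).
    have [||r hr rE] := lift 0%N (\1 - (s \o pr_aug P))%VF.
    - exact/(rhomB (@rhom_id _ _ _))/rhom_comp/pr_aug_rhom.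
    - move=> x; apply: ex; rewrite add_lfunE opp_lfunE comp_lfunE id_lfunE.
      by rewrite linearB /= sE subrr.
    exists r => // x; rewrite -rE add_lfunE opp_lfunE comp_lfunE id_lfunE.
    by rewrite d0 linear0 subr0.
  have [dd ex] := limg_lkerP (pr_exact P j).
  have [||r' hr' r'E] := lift j.+1 (\1 - (r \o pr_diff P j))%VF.
  - exact/(rhomB (@rhom_id _ _ _))/rhom_comp/pr_diff_rhom.
  - move=> x; apply: ex; rewrite add_lfunE opp_lfunE comp_lfunE id_lfunE.
    by rewrite linearB /= rE subrr.
  exists r' => // x; rewrite -r'E add_lfunE opp_lfunE comp_lfunE id_lfunE.
  by rewrite dd linear0 subr0.
exists (f \o r)%VF; first exact: rhom_comp.
apply/lfunP=> x; rewrite !comp_lfunE; apply/eqP; rewrite -subr_eq0 -raddfB /=.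
have [_ ex] := limg_lkerP (pr_exact P j).
have [|y ->] := ex (x - r (pr_diff P j x)); last by rewrite fd.
by rewrite linearB /= rE subrr.
Qed.

End AdditiveClosure.

(** * Suprema of sets of extended integers *)

Section Suprema.
Implicit Types S : set (\bar int).
Local Open Scope classical_set_scope.
Local Open Scope ereal_scope.

Lemma ereal_supremum_exists S : S !=set0 -> (forall x, S x -> 0%E <= x) ->
  supremums S !=set0.
Proof.
move=> [x0 Sx0] S0.
have [[N SN] | unb] := pselect (exists N : nat, forall x, S x -> x <= N%:Z%:E); last first.
  exists +oo; split=> [x _ | y ySub]; first exact: leey.
  case: y ySub => [z | | ] ySub //.
    case: unb; exists `|z|%N => x Sx; apply: le_trans (ySub _ Sx) _.
    by rewrite lee_fin lez_abs.
  by have := le_trans (S0 _ Sx0) (ySub _ Sx0).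
have SE x : S x -> exists2 n : nat, x = n%:Z%:E & (n <= N)%N.
  move=> Sx; move: (S0 _ Sx) (SN _ Sx); case: x {Sx} => [z | | ] //.
  by case: z => // n _; rewrite lee_fin => le; exists n.
have exS : exists n : nat, `[< S n%:Z%:E >].
  by have [n E _] := SE _ Sx0; exists n; apply/asboolP; rewrite -E.
have leS (n : nat) : `[< S n%:Z%:E >] -> (n <= N)%N.
  by move=> /asboolP/SN.
case: (ex_maxnP exS leS) => m /asboolP Sm m_max.
exists m%:Z%:E; split=> [x Sx | y]; last exact.
by have [n E _] := SE _ Sx; rewrite E lee_fin lez_nat m_max //; apply/asboolP; rewrite -E.
Qed.

Lemma le_ereal_supremum S x : (forall y, S y -> 0%E <= y) -> S x ->
  x <= supremum 0%E S.
Proof.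
by move=> S0 Sx; apply: ge_supremum_Nmem => //; apply: ereal_supremum_exists => //; exists x.
Qed.

Lemma ereal_supremum_le S y : (forall x, S x -> 0%E <= x) -> 0%E <= y ->
  (forall x, S x -> x <= y) -> supremum 0%E S <= y.
Proof.
move=> S0 y0 Sy; rewrite /supremum; case: ifPn => // /set0P nS.
have [s Hs] := ereal_supremum_exists nS S0.
by case: xgetP => [_ -> [_] | /(_ s)//]; apply.
Qed.

End Suprema.

(** * Counting summands *)

Section Counting.
Variables (K : fieldType) (A : falgType K).
Implicit Types M X : rmodule A.
Local Open Scope classical_set_scope.

Lemma iso_count_ge0 (Q : rmodule A -> Prop) (x : \bar int) :
  [set c | exists n (X : 'I_n -> rmodule A),
    [/\ forall i, Q (X i), forall i j, riso (X i) (X j) -> i = j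
      & c = (n%:Z)%:E]] x -> (0 <= x)%E.
Proof. by move=> [n [X [_ _ ->]]]; rewrite lee_fin. Qed.

Lemma iso_count_ge (Q : rmodule A -> Prop) n (X : 'I_n -> rmodule A) :
  (forall i, Q (X i)) -> (forall i j, riso (X i) (X j) -> i = j) ->
  ((n%:Z)%:E <= iso_count Q)%E.
Proof.
move=> QX iX; apply: le_ereal_supremum; first exact: iso_count_ge0.
by exists n, X.
Qed.

Lemma iso_count_nonneg (Q : rmodule A -> Prop) : (0 <= iso_count Q)%E.
Proof.
apply: le_trans (iso_count_ge (X := fun i : 'I_0 => regular A) _ _).
- by [].
- by case.
- by case.
Qed.

Lemma num_simples_attained : exists w : nat,
  num_simples A = (w%:Z)%:E /\ exists S : 'I_w -> rmodule A,
    (forall i, is_simple (S i)) /\ (forall i j, riso (S i) (S j) -> i = j).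
Proof.
pose R n := exists S : 'I_n -> rmodule A,
  (forall i, is_simple (S i)) /\ (forall i j, riso (S i) (S j) -> i = j).
have exR : exists n, `[< R n >].
  by exists 0%N; apply/asboolP; exists (fun=> regular A); split; case.
have leR n : `[< R n >] -> (n <= \dim {:A})%N.
  move=> /asboolP[S [sS iS]].
  have H i : exists f : 'Hom(regular A, S i), is_rhom f /\ exists x, f x != 0.
    exact: simple_orbit.
  pose f i := sval (cid (H i)).
  have hf i : is_rhom (f i) /\ exists x, f i x != 0 := svalP (cid (H i)).
  by apply: (simple_count_le (X := regular A) sS iS (fun i => (hf i).1) (fun i => (hf i).2)).
case: (ex_maxnP exR leR) => w /asboolP[S [sS iS]] w_max.
exists w; split; last by exists S.
apply/eqP; rewrite eq_le; apply/andP; split; last exact: iso_count_ge iS.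
apply: ereal_supremum_le => [x | | x].
- exact: iso_count_ge0.
- by rewrite lee_fin.
move=> [n [S' [sS' iS' ->]]]; rewrite lee_fin lez_nat; apply: w_max.
by apply/asboolP; exists S'.
Qed.

Lemma o_ge k M n (X : 'I_n -> rmodule A) :
  ext_perp k (in_add M) (in_add M) ->
  (forall i, is_indecomposable (X i)) -> (forall i, is_retract (X i) M) ->
  (forall i j, riso (X i) (X j) -> i = j) -> ((n%:Z)%:E <= o_ A k)%E.
Proof.
move=> perp iX rX isoX.
have le : ((n%:Z)%:E <= size_mod M)%E.
  apply: (iso_count_ge (X := X)) => // i.
  by split=> //; apply: retract_summand.
apply: (le_trans le); apply: le_ereal_supremum; last by exists M.
by move=> x [M' _ ->]; exact: iso_count_nonneg.
Qed.

(** * Self-orthogonal modules with many summands *)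

Lemma o_ge_num_simples k : (num_simples A <= o_ A k)%E.
Proof.
have [w [-> [S [sS iS]]]] := num_simples_attained.
have [P [iP _ rP isoP]] := simple_projective_covers sS iS.
apply: (o_ge (M := regular A)) iP rP isoP => X Y aX _ [//|j] _.
apply: projective_ext_vanishes.
by apply: in_add_class aX; [exact: projective_class | exact: regular_projective].
Qed.

(** The coresolution is re-indexed so that A itself is its term of index 0. *)
Section Resolution.
Variable I : min_inj_resolution (regular A).

Definition aug_obj (s : nat) : rmodule A :=
  if s is t.+1 then I t else regular A.

Definition aug_diff (s : nat) : 'Hom(aug_obj s, aug_obj s.+1) :=
  match s with 0%N => ir_aug I | t.+1 => ir_diff I t end.

Lemma rhom_aug_diff s : is_rhom (aug_diff s).
Proof. by case: s => [|s]; [exact: ir_aug_rhom | exact: ir_diff_rhom]. Qed.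

Lemma aug_diff_exact s y :
  aug_diff s.+1 y = 0 <-> exists x, y = aug_diff s x.
Proof.
have [H1 H2] : (forall x, aug_diff s.+1 (aug_diff s x) = 0) /\
    (forall y, aug_diff s.+1 y = 0 -> exists x, y = aug_diff s x).
  by apply: limg_lkerP; case: s {y} => [|s]; [exact: ir_exact0 | exact: ir_exact].
by split=> [/H2 | [x ->]].
Qed.

Lemma cosyzygies_exist : exists (C : nat -> rmodule A)
    (p : forall s, 'Hom(aug_obj s, C s)) (i : forall s, 'Hom(C s, aug_obj s.+1)),
  forall s, [/\ is_rhom (p s), is_rhom (i s), forall c, exists x, c = p s x,
    forall c, i s c = 0 -> c = 0 & forall x, aug_diff s x = i s (p s x)].
Proof.
pose C s := sval (cid (image_factorization (@rhom_aug_diff s))).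
have H s : exists (p : 'Hom(aug_obj s, C s)) (i : 'Hom(C s, aug_obj s.+1)),
  [/\ is_rhom p, is_rhom i, forall c, exists x, c = p x,
    forall c, i c = 0 -> c = 0 & forall x, aug_diff s x = i (p x)].
  exact: (svalP (cid (image_factorization (@rhom_aug_diff s)))).
pose p s := sval (cid (H s)); pose i s := sval (cid (svalP (cid (H s)))).
by exists C, p, i => s; exact: (svalP (cid (svalP (cid (H s))))).
Qed.

(** The module M is the direct sum of the cosyzygies of A of indices
    0, k+2, ..., r(k+2), and its counted summands are the w indecomposable
    projectives and a nonprojective summand of each of the r others. Here Ext^n
    between cosyzygies of indices a and b can only be nonzero if n + b is a or
    a - 1, and the step k+2 is the smallest that keeps 1, ..., k away from both
    degrees. *)
Lemma o_ge_num_simples_add k r w :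
  gendo_symmetric A -> ~ selfinjective A ->
  (forall t, (t < r * k.+2)%N -> is_projective (I t)) ->
  num_simples A = (w%:Z)%:E -> (((w + r)%N%:Z)%:E <= o_ A k)%E.
Proof.
move=> /gendo_symmetric_trace_data[T] ninj projI Ew.
have [w' [Ew' [S [sS iS]]]] := num_simples_attained.
have {Ew} -> : w = w' by move: Ew; rewrite Ew' => -[->].
have [C [p [i Cpi]]] := cosyzygies_exist.
have hp s : is_rhom (p s) by case: (Cpi s).
have hi s : is_rhom (i s) by case: (Cpi s).
have ps s y : exists x, y = p s x by case: (Cpi s).
have ii s x : i s x = 0 -> x = 0 by case: (Cpi s) => _ _ _ H _; exact: H.
have Dpi s x : aug_diff s x = i s (p s x) by case: (Cpi s).
have hD := rhom_aug_diff; have exD := aug_diff_exact.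
have injJ s : is_injective (aug_obj s.+1) := @ir_inj _ _ _ I s.
have inj0 : forall x, aug_diff 0 x = 0 -> x = 0.
  by apply/lker_zeroP; exact: ir_aug_inj.
pose N := (r * k.+2)%N.
have projJ s : (s <= N)%N -> is_projective (aug_obj s).
  by case: s => [|s] le; [exact: regular_projective | exact: projI].
have ext0 a : (2 <= a < N)%N -> forall f : 'Hom(aug_obj a, aug_obj 0%N),
    is_rhom f -> (forall x, p a x = 0 -> f x = 0) ->
    exists2 f' : 'Hom(aug_obj a.+1, aug_obj 0%N),
      is_rhom f' & forall x, f x = f' (aug_diff a x).
  case: a => [|[|a]] // /andP[_ aN] f hf fp.
  have leS : (a.+2 <= N)%N := ltnW aN.
  apply: (hom_regular_exact (d1 := aug_diff a.+1) T); try exact: hD.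
  - exact/projJ/ltnW.
  - exact: injJ.
  - exact: projJ.
  - exact: injJ.
  - exact: hf.
  - by move=> y /exD.
  - move=> x; apply: fp; apply: ii; rewrite -Dpi; apply/exD.
    by exists x.
have HE a n : (a <= N)%N -> (0 < n)%N -> n != a -> n.+1 != a ->
    hom_exact aug_diff (C a) n.
  by move=> aN; exact: (hom_exact_cosyzygy hD exD injJ hp hi ps ii Dpi projJ inj0 ext0).
pose c j := (j * k.+2)%N.
have cN j : (j <= r)%N -> (c j <= N)%N by move=> jr; rewrite leq_mul2r jr orbT.
pose M := msum (fun j => C (c j)) r.
have perp : ext_perp k (in_add M) (in_add M).
  move=> X Y aX aY [//|j] /andP[_ jk].
  apply: in_add_class aY; first exact: ext_vanishes_class.
  apply: msum_class; first exact: ext_vanishes_class.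
  move=> b br.
  apply: (hom_exact_ext_vanishes hD exD injJ hp hi ps ii Dpi).
  apply: (in_add_class (hom_exact_class aug_diff _) _ aX).
  apply: (msum_class (hom_exact_class aug_diff _)).
  (* modulo k+2, the degree is j+1, which lies between 1 and k, and c a is 0;
     so the degree is neither c a nor c a - 1 *)
  move=> a ar; apply: HE => //; first exact: cN.
    apply/negP => /eqP/(congr1 (modn^~ k.+2)).
    by rewrite /c -addSn addnC modnMDl modnMl modn_small // ltnS ltnW.
  apply/negP => /eqP/(congr1 (modn^~ k.+2)).
  by rewrite /c -!addSn addnC modnMDl modnMl modn_small.
have [P [iP pP rP isoP]] := simple_projective_covers sS iS.
have HX (j : 'I_r) : exists X, [/\ is_indecomposable X,
    is_retract X (C (c j.+1)) & ~ is_projective X].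
  apply: (@nonprojective_indecomposable _ _ (C (c j.+1))).
  rewrite /c mulSn addSn.
  apply: (cosyzygy_nonprojective exD injJ hp hi ps ii Dpi) => // s le.
  apply: projJ; apply: leq_trans le _.
  by have := cN j.+1 (ltn_ord j); rewrite /c mulSn addSn.
have [X hX] := choice HX.
pose F (l : 'I_(w' + r)) := match split l with inl a => P a | inr j => X j end.
have C0 : is_retract (regular A) M.
  apply: retract_trans (riso_retract (riso_C0 hp ps Dpi inj0)) _.
  exact: (retract_msum (fun j => C (c j)) (leq0n r)).
have noPX a j : ~ riso (P a) (X j).
  move=> /riso_sym/riso_retract R; have [_ _] := hX j; apply.
  exact: retract_projective R (pP a).
have ltX (a b : 'I_r) : (a < b)%N -> ~ riso (X a) (X b).
  move=> ab iso; have [_ rXa nX] := hX a; have [_ rXb _] := hX b; apply: nX.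
  have rXb' := retract_trans (riso_retract iso) rXb.
  have cab : (c a.+1 < c b.+1)%N by rewrite ltn_mul2r.
  have HEab : hom_exact aug_diff (C (c a.+1)) (c b.+1).
    apply: HE => //; first exact: cN.
    - by rewrite neq_ltn cab orbT.
    - by rewrite neq_ltn ltnS (ltnW cab) orbT.
  apply: (cosyzygy_common_retract exD hp hi ps ii Dpi HEab _ rXa rXb') => //.
  exact/projJ/cN.
apply: (o_ge (M := M) (X := F) perp) => [l | l | l l'].
- by rewrite /F; case: (split l) => // j; case: (hX j).
- rewrite /F; case: (split l) => j; first exact: retract_trans (rP j) C0.
  have [_ R _] := hX j; apply: retract_trans R _.
  exact: (retract_msum (fun j => C (c j)) (ltn_ord j)).
rewrite /F => iso; apply: (can_inj (@splitK _ _)); move: iso.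
case: (split l) => a; case: (split l') => b.
- by move=> /isoP ->.
- by move=> /noPX.
- by move=> /riso_sym/noPX.
move=> iso; congr inr; apply: val_inj.
case: (ltngtP a b) => // [/ltX /(_ iso) | /ltX /(_ (riso_sym iso))] //.
Qed.

End Resolution.
End Counting.

(** * The bound on the dominant dimension *)

Section DomdimBound.
Variables (K : fieldType) (A : falgType K).

Lemma domdim_le (b : int) : 0 <= b ->
  (forall (I : min_inj_resolution (regular A)) (n : nat), b <= n%:Z ->
    (forall i, (i <= n)%N -> is_projective (I i)) -> False) ->
  (domdim (regular A) <= b%:E)%E.
Proof.
move=> b0 H; rewrite /domdim; case: xgetP => [_ -> [I ->] | _]; last first.
  by rewrite lee_fin.
rewrite /domdim_res; case: asboolP => [proj0 | _]; last by rewrite lee_fin.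
have b1 : 1 <= b.
  rewrite -gtz0_ge1 lt_neqAle b0 andbT; apply/eqP => E.
  by apply: (H I 0%N) => [|i]; [rewrite -E | rewrite leqn0 => /eqP ->].
rewrite -[b](subrK 1) EFinD leeD2r //.
apply: ereal_supremum_le => [x [n _ ->] | | x [n projI ->]]; rewrite lee_fin //.
  by rewrite subr_ge0.
rewrite leNgt; apply/negP => lt; apply: (H I n _ projI).
by move: lt; lia.
Qed.

End DomdimBound.

Theorem theorem2p7 (K : fieldType) (A : falgType K) (k : nat)
    (hconn : connected_alg A) (hnss : ~ semisimple_alg A)
    (hgendo : gendo_symmetric A) (hnsi : ~ selfinjective A)
    (hk : (1 <= k)%N) :
  (domdim (regular A) <=
   (o_ A k + 2%:E - num_simples A) * (k%:Z + 2)%:E - 1%:E)%E.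
Proof.
have [w [Ew _]] := num_simples_attained A.
have leO := o_ge_num_simples A k; rewrite Ew in leO *.
case EO: (o_ A k) leO => [o | | ] // leO; last first.
  by rewrite gt0_mulye ?leey // lte_fin; lia.
have [v oE] : exists v : nat, o = (w + v)%N%:Z.
  by exists `|o - w%:Z|%N; move: leO; rewrite lee_fin; lia.
rewrite {}oE in EO *; rewrite -EFinD.
apply: domdim_le => [|I n nb projI]; first by nia.
have projr t : (t < v.+1 * k.+2)%N -> is_projective (I t).
  by move=> lt; apply: projI; nia.
have := o_ge_num_simples_add hgendo hnsi projr Ew.
by rewrite EO lee_fin lez_nat; lia.
Qed.
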